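(* Let $\alpha\in[0,1)$ and $\beta,\beta'>0$, and let $A$ and $B$ be invertible m-accretive linear operators on a complex Hilbert space $\mathbb{H}$ such that $D(A)\cap D(B)$ is dense in $\mathbb{H}$, $\Theta(A)\subseteq S_{\alpha,\beta}$ and $\Theta(B)\subseteq S_{\alpha,\beta'}$. Assume in addition that the closure $\overline{A+B}$ of the algebraic sum $A+B$ is m-accretive. Then: (1) $D\big((\overline{A+B})^{1/2}\big)=D\big((\overline{A+B})^{*\,1/2}\big)$; (2) $\Theta(\overline{A+B})\subseteq S_{\alpha,\,2\max(\beta,\beta')}$.
   Context: $\mathbb{H}$ is a complex Hilbert space with inner product $\langle\cdot,\cdot\rangle$; $D(T)$ is the domain of $T$. The numerical range of an operator $T$ is $\Theta(T)=\{\langle Tu,u\rangle:u\in D(T),\ \|u\|=1\}$. For $\alpha\in[0,1)$ and $\beta>0$, $S_{\alpha,\beta}=\{z\in\mathbb{C}:\operatorname{Re}z\ge0\text{ and }|\operatorname{Im}z|\le\beta(\operatorname{Re}z)^\alpha\}$. $T$ is m-accretive if $\operatorname{Re}\langle Tu,u\rangle\ge0$ for all $u\in D(T)$ and, for all $\lambda$ with $\operatorname{Re}\lambda>0$, $(T+\lambda I)^{-1}$ is a bounded everywhere defined operator with $\|(T+\lambda I)^{-1}\|\le1/\operatorname{Re}\lambda$. The algebraic sum has $D(A+B)=D(A)\cap D(B)$ and $(A+B)u=Au+Bu$. $T^{1/2}$ is the usual square root of an m-accretive operator $T$, and $T^{*\,1/2}=(T^* )^{1/2}$. *)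

(* Defs.v *)
From mathcomp Require Import all_boot all_order all_algebra.
From mathcomp Require Import complex.
From mathcomp Require Import all_classical all_reals all_analysis.
Import Order.TTheory GRing.Theory Num.Theory.
Import numFieldNormedType.Exports.

Set Implicit Arguments.
Unset Strict Implicit.
Unset Printing Implicit Defensive.

Local Open Scope classical_set_scope.
Local Open Scope ring_scope.
Local Open Scope complex_scope.

(* The norm of a module over R[i] takes values in R[i], whose order makes
   `dot u u = `|u| ^+ 2` an equation between nonnegative reals. *)
Record hilbertType (R : realType) := HilbertType {
  hilbert_sort :> completeNormedModType R[i];
  dot : {dot hilbert_sort for Num.conj};
  dotE : forall u : hilbert_sort, dot u u = `|u| ^+ 2 }.

(* powR has 0 `^ 0 = 1: at alpha = 0 the region is a closed half-strip. *)
Definition Sregion (R : realType) (alpha beta : R) : set R[i] :=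
  [set z | 0 <= complex.Re z /\ `|complex.Im z| <= beta * complex.Re z `^ alpha].

Section Operators.
Context {R : realType} {H : hilbertType R}.

(* An unbounded operator is identified with its graph. Sums, inverses,
   closures and adjoints are taken among subsets of H * H, and being the graph
   of a linear operator (in particular single-valued) is part of m_accretive. *)
Definition graph := set (H * H)%type.

Implicit Types (T A B : graph) (lambda : R[i]) (M : R).

Definition linear_operator T :=
  [/\ T (0, 0),
      forall (a : R[i]) (p q : (H * H)%type), T p -> T q -> T (a *: p + q)
    & forall v, T (0, v) -> v = 0].

Definition opdom T : set H := [set u | exists v, T (u, v)].

Definition opadd A B : graph :=
  [set p | exists v w, [/\ A (p.1, v), B (p.1, w) & p.2 = v + w]].

Definition scalar_op lambda : graph := [set p | p.2 = lambda *: p.1].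

Definition opadjoint T : graph :=
  [set p | forall q, T q -> dot H q.2 p.1 = dot H q.1 p.2].

Definition numrange T : set R[i] :=
  [set z | exists p, [/\ T p, `|p.1| = 1 & z = dot H p.2 p.1]].

Definition bounded_everywhere M T :=
  [/\ linear_operator T, opdom T = setT
    & forall p, T p -> `|p.2| <= M%:C * `|p.1|].

Definition invertible T := exists M, bounded_everywhere M (T^-1)%relation.

Definition m_accretive T :=
  [/\ linear_operator T,
      forall p, T p -> 0 <= complex.Re (dot H p.2 p.1)
    & forall lambda, 0 < complex.Re lambda ->
        bounded_everywhere (complex.Re lambda)^-1
          ((opadd T (scalar_op lambda))^-1)%relation].

(* The square root of an m-accretive T is its unique m-accretive square root
   (Kato, Perturbation Theory for Linear Operators, Theorem V.3.35); set0 is a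
   dummy value, taken only if T has no such root. *)
Definition opsqrt T : graph :=
  xget set0 [set S : graph | m_accretive S /\ (S \; S)%relation = T].

End Operators.

(* Main.v *)
Require Import Defs.
From mathcomp Require Import all_boot all_order all_algebra.
From mathcomp Require Import complex ring lra.
From mathcomp Require Import all_classical all_reals all_analysis.
Import Order.TTheory GRing.Theory Num.Theory.
Import numFieldNormedType.Exports.

Local Open Scope classical_set_scope.
Local Open Scope ring_scope.
Local Open Scope complex_scope.
Set Implicit Arguments.
Unset Strict Implicit.
Unset Printing Implicit Defensive.

(** For an operator T write h(u) and b(u) for the real and the imaginary part
    of <Tu, u>.  A numerical range inside S_(a,K) means
    |b(u)| <= K h(u)^a |u|^(2-2a).  As x^a is concave, it is the infimum over
    s > 0 of its tangent lines, so this amounts to the family of inequalities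
      |b(u)| <= K s^a (a h(u) / s + (1 - a) |u|^2)      for all s > 0
    ([parabolic]), which are quadratic in (u, Tu) and continuous for the graph
    norm.  They add up ([parabolic_add]; the term |u|^2 is counted twice, hence
    the factor 2), pass to the closure ([parabolic_closure]) and to the adjoint
    ([parabolic_adj]).  Reading them back as a numerical range gives the second
    claim.

    For the first claim let T be the closure and S any m-accretive square root
    of T.  The domain of S is described by T alone: it is the form domain of T,
    made of the limits of sequences v_n in D(T) along which h(v_n) stays bounded
    ([root_domain]).  The form domains of T and of its adjoint agree
    ([form_domain_adj]), because the resolvent regularization
    w = (1 + dT)^-1 u of a u in D(T^* ) lies in D(T) and satisfies
    <Tw, w> = <w, T^* u> - d |Tw|^2.  Finally, T has a root if and only if T^*
    has one, the adjoint of a root being a root of the adjoint ([adj_comp]).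

    The identification of D(S) rests on a comparison between |Su|^2 and h(u), up
    to a multiple of |u|^2 ([core_estimate]), and this is where a < 1 enters.
    The curve u(t) = exp(-tS) u solves u'' = Tu.  Its energy |u'|^2 - h(u) would
    be constant if T were symmetric; in general its derivative is 2 k(u, u'),
    where k is the antisymmetric part of the real form Re <T., .>.  Split
    k(u, u') = k(u - u(0), u') + k(u(0), u').  The second summand integrates to
    the boundary term k(u(0), u(t)), which is of lower order.  In the first one,
    both arguments live at frequencies above 1/t, so that the inequalities for
    s = 1/t bound it by t^-a times the energy, and t^-a is integrable at 0;
    without the splitting, the low frequencies of u against u' would only give
    1/t when a >= 1/2.  The required control of h(u') comes from the convexity
    of |u'|^2, whose second derivative is 2 |u''|^2 + 2 h(u').  The proof
    replaces the semigroup by the implicit Euler scheme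
    u_(j+1) = (1 + eS)^-1 u_j: these computations have discrete versions, exact
    up to an error of order e, so that only finite sums appear, and e tends to 0
    at the very end.

    Compactness is used only in the following form: a decreasing sequence of
    nonempty convex sets that meet a fixed ball has a convergent selection
    ([convex_selection]).  It yields the density of the domain of an m-accretive
    operator, the Riesz representation behind adjoint resolvents, and the
    closing of the form domain. *)

(** * The underlying real inner product space *)

Section Base.
Context {R : realType} {H : hilbertType R}.
Implicit Types (x y z : H) (a b : R).

Definition ip x y : R := complex.Re (dot H x y).
Definition nr x : R := complex.Re `|x|.

Lemma ReD (u v : R[i]) : complex.Re (u + v) = complex.Re u + complex.Re v.
Proof. by case: u v => [? ?] [? ?]. Qed.
Lemma ImD (u v : R[i]) : complex.Im (u + v) = complex.Im u + complex.Im v.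
Proof. by case: u v => [? ?] [? ?]. Qed.

Lemma ipDl x y z : ip (x + y) z = ip x z + ip y z.
Proof. by rewrite /ip linearDl ReD. Qed.
Lemma ipDr x y z : ip z (x + y) = ip z x + ip z y.
Proof. by rewrite /ip linearDr ReD. Qed.
Lemma ReZ a (u : R[i]) : complex.Re (a%:C * u) = a * complex.Re u.
Proof. by case: u => u1 u2 /=; ring. Qed.
Lemma ipZl a x y : ip (a%:C *: x) y = a * ip x y.
Proof. by rewrite /ip linearZl_LR /= ReZ. Qed.
Lemma dotC x y : dot H x y = Num.conj (dot H y x).
Proof. by rewrite hermC expr0 mul1r. Qed.
Lemma ipC x y : ip x y = ip y x.
Proof. by rewrite /ip dotC; case: (dot H y x). Qed.
Lemma ipZr a x y : ip x (a%:C *: y) = a * ip x y.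
Proof. by rewrite ipC ipZl ipC. Qed.
Lemma ipNl x y : ip (- x) y = - ip x y.
Proof. by apply/eqP; rewrite /ip -addr_eq0 -ReD linearNl addNr. Qed.
Lemma ipNr x y : ip x (- y) = - ip x y.
Proof. by rewrite ipC ipNl ipC. Qed.
Definition ipE := (ipDl, ipDr, ipNl, ipNr, ipZl, ipZr).

Lemma ip0l x : ip 0 x = 0.
Proof. by rewrite /ip linear0l. Qed.
Lemma ip0r x : ip x 0 = 0.
Proof. by rewrite ipC ip0l. Qed.

(** Imaginary parts are real inner products too, so that all estimates can be
    carried out with the real bilinear form [ip]. *)
Lemma Im_dot x y : complex.Im (dot H x y) = ip x ('i%C *: y).
Proof. rewrite /ip linearZr_LR /=; case: (dot H x y) => u v. by move=> /=; ring. Qed.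

Lemma nrE x : `|x| = (nr x)%:C.
Proof. by rewrite /nr RRe_real// normr_real. Qed.
Lemma nr_ge0 x : 0 <= nr x.
Proof. by rewrite -ler0c -nrE. Qed.
Lemma ip_nr x : ip x x = nr x ^+ 2.
Proof. by rewrite /ip dotE nrE -rmorphXn. Qed.
Lemma ip_ge0 x : 0 <= ip x x.
Proof. by rewrite ip_nr sqr_ge0. Qed.
Lemma nrD x y : nr (x + y) <= nr x + nr y.
Proof. by rewrite -lecR rmorphD /= -!nrE ler_normD. Qed.
Lemma nrN x : nr (- x) = nr x.
Proof. by rewrite /nr normrN. Qed.
Lemma nrB x y : nr (x - y) = nr (y - x).
Proof. by rewrite -nrN opprB. Qed.
Lemma nrZ a x : nr (a%:C *: x) = `|a| * nr x.
Proof.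
apply: (@complexI R); rewrite rmorphM /= -!nrE normrZ; congr (_ * _).
by rewrite normc_def /= expr0n /= addr0 sqrtr_sqr.
Qed.
Lemma nr0 : nr 0 = 0. Proof. by rewrite /nr normr0. Qed.
Lemma nr_eq0 x : nr x = 0 -> x = 0.
Proof. by move=> h; apply/eqP; rewrite -normr_eq0 nrE h. Qed.
Lemma ip_eq0 x : ip x x = 0 -> x = 0.
Proof. by rewrite ip_nr => /eqP; rewrite sqrf_eq0 => /eqP /nr_eq0. Qed.
Lemma nr_le a x : 0 <= a -> ip x x <= a ^+ 2 -> nr x <= a.
Proof. by move=> a0; rewrite ip_nr ler_pXn2r// ?nnegrE ?nr_ge0. Qed.

Lemma cauchy_schwarz x y : `|ip x y| <= nr x * nr y.
Proof.
have key u v : ip u v <= nr u * nr v.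
  have [u0|u0] := eqVneq (nr u) 0; first by rewrite (nr_eq0 u0) ip0l nr0 mul0r.
  have [v0|v0] := eqVneq (nr v) 0; first by rewrite (nr_eq0 v0) ip0r nr0 mulr0.
  have := ip_ge0 ((nr v)%:C *: u - (nr u)%:C *: v).
  rewrite !ipE (ipC v u) !ip_nr => h.
  have p : 0 < nr u * nr v by rewrite mulr_gt0// lt_neqAle eq_sym ?u0 ?v0 nr_ge0.
  rewrite -subr_ge0 -(pmulr_rge0 _ p); move: h.
  set k := ip u v; set a := nr u; set b := nr v; nra.
rewrite ler_norml key andbT lerNl -ipNl.
by rewrite (le_trans (key _ _))// nrN.
Qed.

Lemma invSn_small (e : R) : 0 < e ->
  exists N, forall n, (N <= n)%N -> n.+1%:R^-1 < e.
Proof.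
move=> e0; exists (Num.truncn e^-1) => n h.
rewrite -[ltRHS]invrK ltf_pV2 ?posrE ?invr_gt0//.
by apply: (lt_le_trans (truncnS_gt _)); rewrite ler_nat ltnS.
Qed.

(** Convergence with real radii: those of the norm topology of H are elements
    of R[i]. *)
Definition tends (k : nat -> H) (l : H) :=
  forall e : R, 0 < e -> exists N, forall n, (N <= n)%N -> nr (k n - l) < e.

Lemma nr_complete (k : nat -> H) :
  (forall e : R, 0 < e -> exists N, forall m n, (N <= m)%N -> (N <= n)%N ->
     nr (k m - k n) < e) -> exists l, tends k l.
Proof.
move=> kC.
have : cvg (k @ \oo).
  apply/cauchy_cvgP/cauchy_ballP => e e0; near_simpl.
  have e0' : 0 < complex.Re e by move: e0; rewrite ltcE => /andP[].
  have eE : e = (complex.Re e)%:C by rewrite RRe_real// gtr0_real.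
  have [N hN] := kC _ e0'.
  near=> m n => /=.
  rewrite -ball_normE /= eE nrE ltcR.
  by apply: hN; [near: m|near: n]; exists N.
move=> /cvg_ex[l kl]; exists l => e e0.
have e0' : 0 < e%:C by rewrite ltcR.
have /cvgrPdist_lt /(_ _ e0') [N _ hN] := kl.
by exists N => n /hN /=; rewrite nrE ltcR nrB.
Unshelve. all: by end_near. Qed.

Lemma closure_approx (X : set (H * H)) p : closure X p ->
  forall e : R, 0 < e -> exists q, [/\ X q, nr (q.1 - p.1) < e & nr (q.2 - p.2) < e].
Proof.
move=> clX e e0.
have e0' : 0 < e%:C by rewrite ltcR.
have [|q [Xq [h1 h2]]] := clX (ball p e%:C); first exact: nbhsx_ballx.
move: h1 h2; rewrite -!ball_normE /= !nrE !ltcR => h1 h2.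
by exists q; split => //; rewrite nrB.
Qed.

Lemma midpoint_identity x y :
  ip (x - y) (x - y) = 2 * ip x x + 2 * ip y y -
    4 * ip (2^-1%:C *: (x + y)) (2^-1%:C *: (x + y)).
Proof. by rewrite !ipE (ipC y x); field. Qed.

(** A substitute for weak compactness.  Almost minimizers of the norm over the
    sets K n form a Cauchy sequence: the midpoint of two of them stays in the
    larger of their two sets, so it cannot be much shorter, and the infima
    increase to a finite limit. *)
Lemma convex_selection (K : nat -> set H) (M : R) :
  (forall n, K n.+1 `<=` K n) ->
  (forall n x y, K n x -> K n y -> K n (2^-1%:C *: (x + y))) ->
  (forall n, exists2 x, K n x & ip x x <= M) ->
  exists (k : nat -> H) (l : H), (forall n, K n (k n)) /\ tends k l.
Proof.
move=> Kdec Kmid Kne.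
have Kle m n : (m <= n)%N -> K n `<=` K m.
  move=> mn; rewrite -(subnKC mn); elim: (n - m)%N => [|d IH].
    by rewrite addn0.
  by rewrite addnS; apply: subset_trans IH.
pose E n := [set r | exists2 x, K n x & r = ip x x].
have Elb n : has_lbound (E n) by exists 0 => _ [x _ ->]; exact: ip_ge0.
have Einf n : has_inf (E n).
  by split => //; have [x Kx _] := Kne n; exists (ip x x), x.
pose d n := inf (E n).
have dle n x : K n x -> d n <= ip x x by move=> Kx; apply: ge_inf => //; exists x.
have dM n : d n <= M by have [x Kx] := Kne n; apply: le_trans; exact: dle.
have dS m n : (m <= n)%N -> d m <= d n.
  move=> mn; apply: lb_le_inf; first by case: (Einf n).
  by move=> _ [x Kx ->]; apply: dle; exact: Kle Kx.
have ex n : exists x, K n x /\ ip x x < d n + n.+1%:R^-1.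
  have n0 : 0 < n.+1%:R^-1 :> R by rewrite invr_gt0.
  by have [_ [x Kx ->] xd] := inf_adherent n0 (Einf n); exists x.
have [k kP] := choice ex.
pose D := sup (range d).
have Dsup : has_sup (range d) by split; [exists (d 0%N), 0%N|exists M => _ [n _ <-]].
have dD n : d n <= D by apply: (ub_le_sup (proj2 Dsup)); exists n.
suff [l kl] : exists l, tends k l.
  by exists k, l; split => // n; have [] := kP n.
apply: nr_complete => e e0.
have e2 : 0 < e ^+ 2 / 16 by rewrite divr_gt0// exprn_gt0.
have [_ [N1 _ <-] hN1] := sup_adherent e2 Dsup.
have [N2 hN2] := invSn_small e2.
have sym m n : (maxn N1 N2 <= m)%N -> (m <= n)%N -> nr (k m - k n) < e.
  rewrite geq_max => /andP[m1 m2] mn.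
  have [Km lm] := kP m; have [Kn ln] := kP n.
  have := dle _ _ (Kmid _ _ _ Km (Kle _ _ mn _ Kn)).
  have := midpoint_identity (k m) (k n).
  have := hN2 _ m2; have := hN2 _ (leq_trans m2 mn).
  have := dS _ _ m1; have := dD n; have := dS _ _ mn.
  rewrite -/D in hN1 *.
  have -> : nr (k m - k n) < e = (ip (k m - k n) (k m - k n) < e ^+ 2).
    by rewrite ip_nr ltr_pXn2r// ?nnegrE ?nr_ge0// ltW.
  move: lm ln; set rm := m.+1%:R^-1; set rn := n.+1%:R^-1; set I := ip (_ *: _) _.
  move: (ip (k m - k n) _) (ip (k m) _) (ip (k n) _) (e ^+ 2) hN1 => I1 I2 I3 E2 ? ? ? ? ? ? ? ? ? ?. lra.
exists (maxn N1 N2) => m n hm hn.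
by case/orP: (leq_total m n) => [|]; [|rewrite nrB]; apply: sym.
Qed.
End Base.

(** * Accretive operators and their resolvents *)

Section Resolvent.
Context {R : realType} {H : hilbertType R}.
Implicit Types (x y z v w : H) (S T : set (H * H)%type) (d e : R).

Section Linear.
Context (T : set (H * H)%type) (Tlin : linear_operator T).

Lemma lin_add x v y w : T (x, v) -> T (y, w) -> T (x + y, v + w).
Proof.
have [_ h _] := Tlin => xv yw.
by have := h 1 _ _ xv yw; rewrite scale1r.
Qed.
Lemma lin_scale (a : R[i]) x v : T (x, v) -> T (a *: x, a *: v).
Proof.
have [h0 h _] := Tlin => xv.
by have := h a _ _ xv h0; rewrite addr0.
Qed.
Lemma lin_opp x v : T (x, v) -> T (- x, - v).
Proof. by move=> /(lin_scale (-1)); rewrite !scaleN1r. Qed.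
Lemma lin_sub x v y w : T (x, v) -> T (y, w) -> T (x - y, v - w).
Proof. by move=> xv yw; apply: lin_add => //; exact: lin_opp. Qed.
End Linear.

Lemma nr_small x : (forall e, 0 < e -> nr x <= e) -> x = 0.
Proof.
move=> h; apply: nr_eq0; apply/eqP; rewrite eq_le nr_ge0 andbT.
by apply/ler_addgt0Pr => e e0; rewrite add0r h.
Qed.

Definition accretive T := forall x v, T (x, v) -> 0 <= ip v x.

Lemma m_accretive_lin T : m_accretive T -> linear_operator T.
Proof. by case. Qed.
Lemma m_accretive_acc T : m_accretive T -> accretive T.
Proof. by move=> [_ h _] x v /h. Qed.
Lemma opadd_scalarE T (l : R[i]) x y :
  opadd T (scalar_op l) (x, y) = T (x, y - l *: x).
Proof.
apply/propext; split; last first.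
  by move=> h; exists (y - l *: x), (l *: x); split => //=; rewrite subrK.
move=> [v [w [/= h /= wE ->]]].
by move: wE; rewrite /scalar_op /= => ->; rewrite addrK.
Qed.
Lemma m_accretive_res T (l : R[i]) y : m_accretive T -> 0 < complex.Re l ->
  exists x, T (x, y - l *: x).
Proof.
move=> [_ _ h] /h [_ /= hd _].
have : opdom ((opadd T (scalar_op l))^-1)%relation y by rewrite hd.
by move=> [x]; rewrite /= opadd_scalarE; exists x.
Qed.

Lemma scaleC_Re (l : R[i]) x : ip (l *: x) x = complex.Re l * ip x x.
Proof.
rewrite /ip linearZl_LR /= dotE nrE -rmorphXn.
by case: l => a b /=; ring.
Qed.

Lemma accretive_bound T (l : R[i]) x y : accretive T ->
  T (x, y - l *: x) -> complex.Re l * nr x <= nr y.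
Proof.
move=> Tacc /Tacc; rewrite ipDl ipNl scaleC_Re => h.
have := cauchy_schwarz y x; rewrite ler_norml => /andP[_] h1.
rewrite ip_nr in h.
have [x0|x0] := eqVneq (nr x) 0; first by rewrite x0 mulr0 nr_ge0.
have px : 0 < nr x by rewrite lt_neqAle eq_sym x0 nr_ge0.
by rewrite -(ler_pM2r px); rewrite -mulrA -expr2; lra.
Qed.

(** Accretivity alone provides the injectivity of T + l and the norm bound on
    its inverse; only surjectivity remains to be assumed. *)
Lemma m_accretive_of_range T : linear_operator T -> accretive T ->
  (forall (l : R[i]) y, 0 < complex.Re l -> exists x, T (x, y - l *: x)) ->
  m_accretive T.
Proof.
move=> Tlin Tacc Tres; split => //; first by move=> [x v] /Tacc.
move=> l l0.
have bnd y x := @accretive_bound _ l x y Tacc.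
split.
- split.
  + by rewrite /= opadd_scalarE scaler0 subr0; case: Tlin.
  + move=> a [y x] [z w]; rewrite /= !opadd_scalarE => Tx Tw.
    have := lin_add Tlin (lin_scale Tlin a Tx) Tw.
    by rewrite scalerBr addrACA scalerA mulrC -scalerA -opprD -scalerDr.
  + move=> x; rewrite /= opadd_scalarE => /bnd; rewrite nr0 pmulr_rle0// => h.
    by apply: nr_eq0; apply/eqP; rewrite eq_le h nr_ge0.
- apply/seteqP; split => // y _; have [x Tx] := Tres l y l0.
  by exists x; rewrite /= opadd_scalarE.
- move=> [y x]; rewrite /= opadd_scalarE => /bnd h.
  by rewrite !nrE -rmorphM lecR -(ler_pM2l l0) mulrA divff ?gt_eqF// mul1r.
Qed.

(** The resolvent (1 + d T)^-1, the implicit Euler step of length d of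
    x' = - T x. *)
Definition res T d y : H := xget 0 [set x | T (x, d^-1%:C *: (y - x))].

Lemma scaleKl d x : 0 < d -> d%:C *: (d^-1%:C *: x) = x.
Proof. by move=> d0; rewrite scalerA -rmorphM divff ?gt_eqF// rmorph1 scale1r. Qed.
Lemma scaleKr d x : 0 < d -> d^-1%:C *: (d%:C *: x) = x.
Proof. by move=> d0; rewrite scalerA -rmorphM mulVf ?gt_eqF// rmorph1 scale1r. Qed.

Lemma midpoint_refl x : 2^-1%:C *: (x + x) = x.
Proof.
have -> : x + x = 2%:C *: x by rewrite rmorphD rmorph1 scalerDl scale1r.
by rewrite scaleKr.
Qed.

Section Res.
Context (T : set (H * H)%type) (hT : m_accretive T).
Let Tlin := m_accretive_lin hT.
Let Tacc := m_accretive_acc hT.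

Lemma resP d y : 0 < d -> T (res T d y, d^-1%:C *: (y - res T d y)).
Proof.
move=> d0; apply: (@xgetPex _ 0 [set x | T (x, d^-1%:C *: (y - x))]).
have [|x Tx] := @m_accretive_res T (d^-1%:C) (d^-1%:C *: y) hT.
  by rewrite /= invr_gt0.
by exists x; rewrite /= scalerBr.
Qed.

Lemma res_bound d x v : 0 < d -> T (x, v) -> nr x <= nr (x + d%:C *: v).
Proof.
move=> d0 Txv; have h := Tacc Txv.
apply: nr_le; rewrite ?nr_ge0// -ip_nr !ipE (ipC x v).
by have := mulr_ge0 (ltW d0) h; have := mulr_ge0 (ltW d0) (mulr_ge0 (ltW d0) (ip_ge0 v)); lra.
Qed.

Lemma res_uniq d x v : 0 < d -> T (x, v) -> res T d (x + d%:C *: v) = x.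
Proof.
move=> d0 Txv; set y := x + _; have h := resP y d0.
have := res_bound d0 (lin_sub Tlin h Txv).
rewrite scalerBr scaleKl//.
rewrite (_ : _ - x + _ = 0) ?nr0.
  move=> a; apply/eqP; rewrite -subr_eq0; apply/eqP/nr_eq0.
  by apply/eqP; rewrite eq_le a nr_ge0.
by rewrite addrACA -opprD -/y [_ + (y - _)]addrC subrK subrr.
Qed.

Lemma res_eq d x y : 0 < d -> T (x, d^-1%:C *: (y - x)) -> res T d y = x.
Proof.
by move=> d0 /(res_uniq d0); rewrite scaleKl// addrC subrK.
Qed.

Lemma resD d x y : 0 < d -> res T d (x + y) = res T d x + res T d y.
Proof.
move=> d0; apply: res_eq => //.
have := lin_add Tlin (resP x d0) (resP y d0); rewrite -scalerDr.
by rewrite addrACA -opprD.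
Qed.
Lemma resZ d (a : R[i]) x : 0 < d -> res T d (a *: x) = a *: res T d x.
Proof.
move=> d0; apply: res_eq => //.
have := lin_scale Tlin a (resP x d0).
by rewrite scalerA mulrC -scalerA scalerBr.
Qed.
Lemma resN d x : 0 < d -> res T d (- x) = - res T d x.
Proof. by move=> d0; rewrite -scaleN1r resZ// scaleN1r. Qed.
Lemma resB d x y : 0 < d -> res T d (x - y) = res T d x - res T d y.
Proof. by move=> d0; rewrite resD// resN. Qed.
Lemma res_nr d x : 0 < d -> nr (res T d x) <= nr x.
Proof.
move=> d0; have := res_bound d0 (resP x d0).
by rewrite scaleKl// addrC subrK.
Qed.

Lemma res_comm d x v : 0 < d -> T (x, v) -> T (res T d x, res T d v).
Proof.
move=> d0 Txv; have h := resP x d0; set x' := res T d x in h *.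
suff -> : res T d v = d^-1%:C *: (x - x') by [].
apply: res_eq => //.
by have := lin_scale Tlin d^-1%:C (lin_sub Tlin Txv h).
Qed.

Lemma res_dom d x v : 0 < d -> T (x, v) -> x - res T d x = d%:C *: res T d v.
Proof.
by move=> d0 Txv; rewrite -{1}(res_uniq d0 Txv) resD// resZ// addrAC subrr add0r.
Qed.

Lemma res_dist d x v : 0 < d -> T (x, v) -> nr (res T d x - x) <= d * nr v.
Proof.
move=> d0 Txv; rewrite nrB (res_dom d0 Txv) nrZ gtr0_norm// ler_pM2l//.
exact: res_nr.
Qed.

(** The graph is cut out by the equation (1 + T)^-1 (x + y) = x between
    continuous functions of (x, y). *)
Lemma m_accretive_closed x y :
  (forall e, 0 < e -> exists p, [/\ T p, nr (p.1 - x) < e & nr (p.2 - y) < e]) ->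
  T (x, y).
Proof.
move=> h; have := resP (x + y) ltr01; rewrite invr1 scale1r.
suff -> : res T 1 (x + y) = x by rewrite addrAC subrr add0r.
apply/eqP; rewrite -subr_eq0; apply/eqP; apply: nr_small => e e0.
have [|[a b] /= [Tab h1 h2]] := h (e / 3); first by rewrite divr_gt0.
have := res_uniq ltr01 Tab; rewrite scale1r => E.
have -> : res T 1 (x + y) - x = res T 1 ((x - a) + (y - b)) + (a - x).
  by rewrite addrACA -opprD resB// E addrA subrK.
apply: (le_trans (nrD _ _)); have := res_nr ((x - a) + (y - b)) ltr01.
have := nrD (x - a) (y - b); rewrite (nrB x) (nrB y); lra.
Qed.

(** The approximants (1 + d T)^-1 y are bounded, and as d tends to 0 their
    images under (1 + T)^-1 converge to the image of y.  Selecting from the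
    convex sets of points of the domain with almost the same image as y gives a
    limit with exactly the same image, which is y by injectivity. *)
Lemma m_accretive_dense y e : 0 < e -> exists2 x, opdom T x & nr (x - y) < e.
Proof.
pose K n := [set x | opdom T x /\ nr (res T 1 x - res T 1 y) < n.+1%:R^-1].
have [||n|k [l [Kk kl]]] := @convex_selection _ _ K (ip y y).
- move=> n x [hx hy]; split=> //; apply: (lt_trans hy).
  by rewrite ltf_pV2 ?posrE// ltr_nat.
- move=> n x x' [[v hx] hy] [[v' hx'] hy']; split.
    by exists (2^-1%:C *: (v + v')); apply: lin_scale => //; apply: lin_add.
  rewrite resZ// resD// -(midpoint_refl (res T 1 y)) -scalerBr nrZ.
  rewrite gtr0_norm ?invr_gt0//.
  rewrite opprD addrACA.
  have := nrD (res T 1 x - res T 1 y) (res T 1 x' - res T 1 y).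
  by move: (n.+1%:R^-1) hy hy' => r; lra.
- have Ty := resP y ltr01; move: Ty; set v := _ *: _ => Ty.
  pose d : R := (n.+1%:R * (1 + nr v))^-1.
  have v1 : 0 < 1 + nr v by have := nr_ge0 v; lra.
  have d0 : 0 < d by rewrite invr_gt0 mulr_gt0.
  exists (res T d y); last first.
    by rewrite !ip_nr ler_pXn2r ?nnegrE ?nr_ge0// res_nr.
  split; first by exists (d^-1%:C *: (y - res T d y)); exact: resP.
  have -> : res T 1 (res T d y) = res T d (res T 1 y).
    apply: res_eq => //; have := res_comm d0 Ty.
    by rewrite /v resZ// resB.
  apply: (le_lt_trans (res_dist d0 Ty)).
  rewrite /d invfM -mulrA gtr_pMr ?invr_gt0// mulrC ltr_pdivrMr// mul1r; lra.
- have ly : l = y.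
    suff : l - y = 0 by move=> /eqP; rewrite subr_eq0 => /eqP.
    have r0 : res T 1 (l - y) = 0.
      apply: nr_small => e' e'0.
      have [N hN] := kl (e' / 2) (divr_gt0 e'0 (ltr0Sn _ 1)).
      have [M hM] := invSn_small (divr_gt0 e'0 (ltr0Sn _ 1)); pose n := maxn N M.
      have h1 := hN n (leq_maxl _ _).
      have [_ h2] := Kk n.
      have h3 := hM n (leq_maxr _ _).
      rewrite (_ : l - y = (l - k n) + (k n - y)); last by rewrite addrA subrK.
      rewrite resD//; apply: (le_trans (nrD _ _)); rewrite (resB (k n))//.
      have := res_nr (l - k n) ltr01; rewrite nrB in h1.
      move: (n.+1%:R^-1) h2 h3 => r; lra.
    have := resP (l - y) ltr01; rewrite r0 subr0 invr1 scale1r.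
    by have [_ _] := Tlin; apply.
  move=> e0; have [N hN] := kl e e0.
  by exists (k N); [case: (Kk N)|rewrite -ly; exact: hN].
Qed.

Lemma res_cvg y e : 0 < e ->
  exists2 d0, 0 < d0 & forall d, 0 < d -> d < d0 -> nr (res T d y - y) < e.
Proof.
move=> e0; have [x [v Txv] xy] := @m_accretive_dense y _ (divr_gt0 e0 (ltr0Sn _ 2)).
have v1 : 0 < 1 + nr v by have := nr_ge0 v; lra.
exists (e / 3 / (1 + nr v)); first by rewrite !divr_gt0.
move=> d d0; rewrite ltr_pdivlMr// mulrDr mulr1 => dd.
have -> : res T d y - y = res T d (y - x) + (res T d x - x) + (x - y).
  by rewrite resB// !addrA !subrK.
apply: (le_lt_trans (nrD _ _)).
have := nrD (res T d (y - x)) (res T d x - x).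
have := res_nr (y - x) d0; have := res_dist d0 Txv.
rewrite (nrB y x); lra.
Qed.

(** An m-accretive operator has no proper accretive extension: the range of
    1 + T is already everything, and 1 + S is injective. *)
Lemma m_accretive_max S : linear_operator S -> accretive S -> T `<=` S -> S = T.
Proof.
move=> Slin Sacc TS; apply/seteqP; split => // -[x v] Sxv.
have Tz := resP (x + v) ltr01; rewrite invr1 scale1r in Tz.
set z := res T 1 _ in Tz.
have := lin_sub Slin (TS _ Tz) Sxv => /Sacc.
rewrite (_ : _ - v = - (z - x)); last by rewrite opprB addrAC addrK.
rewrite ipNl oppr_ge0 => h.
have zx : z = x.
  apply/eqP; rewrite -subr_eq0; apply/eqP/ip_eq0/eqP.
  by rewrite eq_le h ip_ge0.
by move: Tz; rewrite zx addrAC subrr add0r.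
Qed.
End Res.
End Resolvent.

(** * Riesz representation and adjoints *)

Section Adjoint.
Context {R : realType} {H : hilbertType R}.
Implicit Types (x y z v w u f : H) (S T : set (H * H)%type) (d e : R).

(** The representing vector minimizes |v|^2 - 2 g v. *)
Lemma riesz (g : H -> R) (C : R) :
  (forall x y, g (x + y) = g x + g y) ->
  (forall a x, g (a%:C *: x) = a * g x) ->
  (forall x, `|g x| <= C * nr x) ->
  exists v, forall x, ip x v = g x.
Proof.
move=> gD gZ gC.
pose F v := ip v v - 2 * g v.
have Flb v : (nr v - C) ^+ 2 - C ^+ 2 <= F v.
  rewrite /F ip_nr; have := gC v; rewrite ler_norml => /andP[_]; nra.
pose E := [set F v | v in setT].
have Einf : has_inf E.
  split; first by exists (F 0), 0.
  exists (- C ^+ 2) => _ [v _ <-]; apply: le_trans (Flb v).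
  by have := sqr_ge0 (nr v - C); lra.
pose m := inf E.
have mF v : m <= F v by apply: ge_inf; [case: Einf|exists v].
pose K n := [set v | F v < m + n.+1%:R^-1].
have [||n|k [l [Kk kl]]] := @convex_selection _ _ K (2 * (m + 1 + C ^+ 2) + 2 * C ^+ 2).
- move=> n x hx; apply: (lt_trans hx).
  by rewrite ltrD2l ltf_pV2 ?posrE// ltr_nat.
- move=> n x y; rewrite /K /= /F => hx hy.
  have := midpoint_identity x y; rewrite gZ gD.
  have := ip_ge0 (x - y); move: (n.+1%:R^-1) hx hy => r.
  move: (ip (_ *: _) _) (ip (x - y) _) (ip x x) (ip y y) => a b c d; lra.
- have n0 : 0 < n.+1%:R^-1 :> R by rewrite invr_gt0.
  have [_ [v _ <-] vm] := inf_adherent n0 Einf; exists v => //.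
  have := Flb v; rewrite ip_nr; have := sqr_ge0 (nr v - 2 * C).
  have : n.+1%:R^-1 <= 1 :> R by rewrite invf_le1// ler1n.
  by move: (n.+1%:R^-1) vm => r; rewrite -/m; move: (nr v) (F v) => a b; nra.
exists l => x; apply/eqP; rewrite -subr_eq0; apply/eqP.
set a := _ - _.
have key t : 0 <= 2 * t * a + t ^+ 2 * ip x x.
  apply/ler_addgt0Pr => e e0.
  have q0 : 0 < 1 + 2 * `|t| * nr x.
    by have := mulr_ge0 (normr_ge0 t) (nr_ge0 x); lra.
  have e2 := divr_gt0 e0 (ltr0Sn R 1).
  have [N hN] := kl _ (divr_gt0 e2 q0).
  have [M hM] := invSn_small e2; pose n := maxn N M.
  have := hN n (leq_maxl _ _); rewrite ltr_pdivlMr// => h1.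
  have := hM n (leq_maxr _ _) => h2.
  have := mF (k n + t%:C *: x); have := Kk n; rewrite /K /F /= gD gZ !ipE.
  have : 2 * t * ip x (k n) <= 2 * t * ip x l + 2 * `|t| * nr x * nr (k n - l).
    rewrite -lerBlDl -mulrBr -ipNr -ipDr -!mulrA ler_pM2l//.
    apply: (le_trans (ler_norm _)); rewrite normrM ler_wpM2l//.
    exact: cauchy_schwarz.
  have : nr (k n - l) >= 0 by exact: nr_ge0.
  rewrite (ipC (k n) x) /a; move: (n.+1%:R^-1) h2 => r.
  set z := 2 * `|t| * nr x in q0 h1 *; move: (nr (k n - l)) h1 => y.
  move: (ip x (k n)) (ip x l) (ip x x) => ? ? ?; nra.
have [x0|x0] := eqVneq (ip x x) 0.
  have z0 : x = 0 := ip_eq0 x0.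
  by rewrite /a z0 ip0l -(scaler0 _ (0 : R)%:C) gZ mul0r subrr.
have x1 : 0 < ip x x by rewrite lt_neqAle eq_sym x0 ip_ge0.
have := key (- a / ip x x).
rewrite (_ : _ + _ = - (a ^+ 2 / ip x x)); last by field.
rewrite oppr_ge0 pmulr_lle0 ?invr_gt0// => h.
by apply/eqP; rewrite -sqrf_eq0 eq_le h sqr_ge0.
Qed.

Lemma dense_ortho T v : m_accretive T ->
  (forall x y, T (x, y) -> ip x v = 0) -> v = 0.
Proof.
move=> hT h; apply: nr_small => e e0.
have [x [y Txy] xv] := m_accretive_dense hT v e0.
have := cauchy_schwarz (v - x) v.
rewrite ipDl ipNl (h _ _ Txy) subr0 ip_nr ler_norml nrB => /andP[_ h2].
have [v0|v0] := eqVneq (nr v) 0; first by rewrite v0 ltW.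
have v1 : 0 < nr v by rewrite lt_neqAle eq_sym v0 nr_ge0.
by rewrite -(ler_pM2r v1) -expr2 (le_trans h2)// ler_pM2r// ltW.
Qed.

Lemma ip_ext v w : (forall x, ip x v = ip x w) -> v = w.
Proof.
move=> h; apply/eqP; rewrite -subr_eq0; apply/eqP/ip_eq0.
by rewrite ipDr ipNr h subrr.
Qed.

Lemma Im_dotl x y : complex.Im (dot H x y) = - ip ('i%C *: x) y.
Proof.
by rewrite /ip linearZl_LR /=; case: (dot H x y) => a b /=; ring.
Qed.

Lemma adj_linear T : m_accretive T -> linear_operator (opadjoint T).
Proof.
move=> hT; split.
- by move=> q _; rewrite /= !linear0r.
- move=> a p q hp hq r Tr; rewrite /= !linearDr !linearZr_LR /=.
  by rewrite (hp _ Tr) (hq _ Tr).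
- move=> v hv; apply: (dense_ortho hT) => x y /hv /=.
  by rewrite linear0r /ip => <-.
Qed.

Section Approx.
Context (T : set (H * H)%type) (hT : m_accretive T).

(** Regularizing an element u of the domain of the adjoint by the resolvent of T
    moves it into the domain of T: with g = T w and u - w = d g,
    <g, w> = <g, u> - d |g|^2, and <g, u> is <w, T^* u>.  So the real part can
    only drop, while the imaginary part is unchanged. *)
Lemma adj_res u f d : 0 < d -> opadjoint T (u, f) ->
  exists g, T (res T d u, g) /\
    dot H g (res T d u) = dot H (res T d u) f - (d * ip g g)%:C.
Proof.
move=> d0 hu; set w := res T d u; have Tw := resP hT u d0.
exists (d^-1%:C *: (u - w)); split => //; rewrite -/w in Tw *.
set g := _ *: _ in Tw *.
have gE : d%:C *: g = u - w by rewrite scaleKl.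
have {1}-> : w = u - d%:C *: g by rewrite gE opprB addrC subrK.
rewrite linearBr linearZr_LR /= (hu _ Tw) /= rmorphM; congr (_ - _).
rewrite ip_nr dotE nrE -rmorphXn; congr (_ * _).
by rewrite -[LHS]/(conjc _) conjc_real.
Qed.

Lemma adj_res_ip u f d : 0 < d -> opadjoint T (u, f) ->
  exists g, [/\ T (res T d u, g), ip g (res T d u) <= ip (res T d u) f &
    complex.Im (dot H g (res T d u)) = complex.Im (dot H (res T d u) f)].
Proof.
move=> d0 /(adj_res d0) [g [Tg E]]; exists g; split => //.
- by rewrite /ip E; case: (dot H _ f) => a b /=; rewrite lerBlDr lerDl mulr_ge0 ?ip_ge0// ltW.
- by rewrite E; case: (dot H _ f) => a b /=; rewrite subr0.
Qed.

Lemma res_ip u f e : 0 < e -> exists2 d, 0 < d &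
  nr (res T d u - u) < e /\ `|ip (res T d u) f - ip u f| < e.
Proof.
move=> e0; have f1 : 0 < 1 + nr f by have := nr_ge0 f; lra.
have [d0 d00 hd] := res_cvg hT u (divr_gt0 e0 f1).
exists (d0 / 2); first by rewrite divr_gt0.
have := hd (d0 / 2) (divr_gt0 d00 (ltr0Sn _ 1)).
have -> : d0 / 2 < d0 by lra.
move=> /(_ isT); rewrite ltr_pdivlMr// => h.
have := nr_ge0 f; have := nr_ge0 (res T (d0 / 2) u - u) => h1 h2.
split; first by nra.
have := cauchy_schwarz (res T (d0 / 2) u - u) f; rewrite ipDl ipNl.
nra.
Qed.

Lemma adj_accretive : accretive (opadjoint T).
Proof.
move=> u f hu; rewrite ipC; apply/ler_addgt0Pr => e e0.
have [d d0 [_ h]] := res_ip u f e0.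
have [g [Tg h1 _]] := adj_res_ip d0 hu.
have := m_accretive_acc hT Tg.
by move: h; rewrite ltr_norml => /andP[? ?]; lra.
Qed.

(** The range condition asks for v with <z, v> = <(T + conj l)^-1 z, f> for all
    z, which is a bounded functional of z. *)
Lemma adj_m_accretive : m_accretive (opadjoint T).
Proof.
apply: m_accretive_of_range; [exact: adj_linear|exact: adj_accretive|].
move=> l f l0.
have [Tlin Tacc] := (m_accretive_lin hT, m_accretive_acc hT).
have m0 : 0 < complex.Re (conjc l) by case: l l0.
have [Q TQ] := choice (fun z => m_accretive_res z hT m0).
have Quniq x z : T (x, z - conjc l *: x) -> Q z = x.
  move=> Tx; apply/eqP; rewrite -subr_eq0; apply/eqP/nr_eq0/eqP.
  rewrite eq_le nr_ge0 andbT -(pmulr_rle0 _ m0).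
  rewrite -(@nr0 R H); apply: accretive_bound Tacc _.
  rewrite (_ : 0 - _ = (z - conjc l *: Q z) - (z - conjc l *: x)).
    exact: lin_sub.
  by rewrite sub0r scalerBr opprB [RHS]addrC opprB addrA subrK.
have QD x y : Q (x + y) = Q x + Q y.
  apply: Quniq; have := lin_add Tlin (TQ x) (TQ y).
  by rewrite addrACA -opprD -scalerDr.
have QZ a x : Q (a *: x) = a *: Q x.
  apply: Quniq; have := lin_scale Tlin a (TQ x).
  by rewrite scalerBr !scalerA mulrC.
have [||x|v hv] := @riesz (fun z => ip (Q z) f) ((complex.Re (conjc l))^-1 * nr f).
- by move=> x y; rewrite QD ipDl.
- by move=> a x; rewrite QZ ipZl.
- apply: (le_trans (cauchy_schwarz _ _)).
  have := accretive_bound Tacc (TQ x); rewrite mulrC -ler_pdivlMr//.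
  by move=> h; rewrite [leRHS]mulrAC ler_wpM2r ?nr_ge0// mulrC.
exists v => -[x y] Txy /=.
have Qz : Q (y + conjc l *: x) = x by apply: Quniq; rewrite addrK.
have E z : dot H z v = dot H (Q z) f.
  apply/eqP; rewrite eq_complex; apply/andP; split; apply/eqP.
    exact: hv.
  by rewrite !Im_dotl hv QZ.
rewrite linearBr linearZr_LR /= -[in X in X - _]Qz -E linearDl linearZl_LR /=.
by rewrite addrK.
Qed.

End Approx.

Lemma adj_adj T : m_accretive T -> opadjoint (opadjoint T) = T.
Proof.
move=> hT; have hA := adj_m_accretive hT.
apply: m_accretive_max => //; [exact: adj_linear|exact: adj_accretive|].
move=> q Tq p hp.
by rewrite dotC -(hp _ Tq) -dotC.
Qed.

(** With K the adjoint of J = (1 + S)^-1, testing T^* u = f against J^2 z gives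
    u = K (2 u - K u + K f).  So u lies in the range of K, the domain of the
    adjoint of S, and its image u - K u + K f lies there as well. *)
Lemma adj_comp S T : m_accretive S -> (S \; S)%relation = T ->
  (opadjoint S \; opadjoint S)%relation = opadjoint T.
Proof.
move=> hS ST; have hA := adj_m_accretive hS.
have [Alin Slin] := (m_accretive_lin hA, m_accretive_lin hS).
apply/seteqP; split=> [[u f] /= [g Aug Agf] [x y]|[u f] hu].
  rewrite -ST => -[w /= Sxw Swy].
  by rewrite (Aug _ Swy) (Agf _ Sxw).
pose J := res S 1; pose K := res (opadjoint S) 1.
have JP y : S (J y, y - J y) by have := resP hS y ltr01; rewrite invr1 scale1r.
have KP y : opadjoint S (K y, y - K y).
  by have := resP hA y ltr01; rewrite invr1 scale1r.
have JK x y : ip (J x) y = ip x (K y).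
  have /(congr1 (@complex.Re R)) := KP y _ (JP x).
  by rewrite -/(ip _ _) -/(ip _ _) !ipE /=; lra.
have E : u = K (u + u - K u + K f).
  apply: ip_ext => z.
  have S1 : S (J (J z), J z - J (J z)) := JP (J z).
  have S2 : S (J z - J (J z), z - J z - (J z - J (J z))).
    exact: lin_sub (JP z) (JP (J z)).
  have : T (J (J z), z - J z - (J z - J (J z))) by rewrite -ST; exists (J z - J (J z)).
  move=> /hu /= /(congr1 (@complex.Re R)); rewrite -/(ip _ _) -/(ip _ _).
  rewrite /K !(resD hA) ?(resN hA)// -/K !ipE !JK.
  lra.
pose g := u - K u + K f.
have Eg : u + u - K u + K f - u = g by rewrite /g -!addrA addrC -!addrA; congr (_ + _); rewrite !addrA subrK.
exists g => /=.
  by have := KP (u + u - K u + K f); rewrite -E Eg.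
have gK : K (g + f) = g.
  by rewrite /K resD// -{1}Eg resB// -/K -E.
by have := KP (g + f); rewrite gK addrAC subrr add0r.
Qed.
End Adjoint.

(** * Parabolic numerical ranges *)

Section Parabolic.
Context {R : realType} {H : hilbertType R}.
Implicit Types (x y z v w u f : H) (S T : set (H * H)%type) (d e s a K : R).

(** The tangent line form of the inclusion of the numerical range in S_(a,K):
    for |x| = 1, the infimum of the right-hand side over s is K h^a, where h is
    the real part of <Tx, x>. *)
Definition parabolic K a T := forall x v, T (x, v) -> forall s, 0 < s ->
  `|complex.Im (dot H v x)| <= K * s `^ a * (a * (ip v x / s) + (1 - a) * ip x x).

(** Weighted arithmetic-geometric mean inequality for x / s and 1. *)
Lemma powR_tangent a (x : R) s : 0 <= a <= 1 -> 0 <= x -> 0 < s ->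
  x `^ a <= s `^ a * (a * (x / s) + (1 - a)).
Proof.
move=> /andP[a0 a1] x0 s0; have sa := powR_gt0 a s0.
have [->|an0] := eqVneq a 0; first by rewrite !powRr0 mul0r subr0 add0r mul1r.
have [->|an1] := eqVneq a 1.
  by rewrite !powRr1 ?(ltW s0)// subrr addr0 mul1r mulrC divfK// gt_eqF.
have ap : 0 < a by rewrite lt_neqAle eq_sym an0.
have b0 : 0 < 1 - a by rewrite subr_gt0 lt_neqAle an1.
have xs : 0 <= x / s by rewrite divr_ge0// ltW.
have -> : x `^ a = s `^ a * (x / s) `^ a.
  by rewrite -powRM ?(ltW s0)// mulrC divfK ?gt_eqF.
rewrite ler_pM2l//.
have := @conjugate_powR R ((x / s) `^ a) 1 a^-1 (1 - a)^-1 (powR_ge0 _ _) ler01.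
rewrite !invr_gt0 !invrK powR1 -powRrM mulfV// powRr1// mulr1 mul1r.
by move=> h; rewrite [a * _]mulrC; apply: h => //; lra.
Qed.

Lemma nr_i x : nr ('i%C *: x) = nr x.
Proof. by rewrite /nr normrZ normc_def /= expr0n expr1n /= add0r sqrtr1 mul1r. Qed.

Lemma dot_scale (b : R) v x :
  dot H (b%:C *: v) (b%:C *: x) = (b ^+ 2)%:C * dot H v x.
Proof.
rewrite linearZl_LR linearZr_LR /= rmorphXn mulrA; congr (_ * _).
by rewrite expr2; congr (_ * _); rewrite -[LHS]/(conjc _) conjc_real.
Qed.

Lemma ImZ b (u : R[i]) : complex.Im (b%:C * u) = b * complex.Im u.
Proof. by case: u => u1 u2 /=; ring. Qed.

Lemma numrange_parabolic K a T : 0 <= K -> 0 <= a -> a < 1 ->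
  linear_operator T -> numrange T `<=` Sregion a K -> parabolic K a T.
Proof.
move=> K0 a0 a1 Tlin TS x v Txv s s0.
have [x0|x0] := eqVneq (nr x) 0.
  move: Txv; rewrite (nr_eq0 x0) !ip0r linear0r normr0.
  by rewrite mul0r !mulr0 addr0 mulr0.
have xp : 0 < nr x by rewrite lt_neqAle eq_sym x0 nr_ge0.
have xb : 0 < ip x x by rewrite ip_nr exprn_gt0.
pose b := (nr x)^-1.
have b2 : b ^+ 2 = (ip x x)^-1 by rewrite /b ip_nr exprVn.
have [] := TS (dot H (b%:C *: v) (b%:C *: x)).
  exists (b%:C *: x, b%:C *: v); split => //=; first exact: lin_scale.
  by rewrite nrE nrZ gtr0_norm ?invr_gt0// mulVf// gt_eqF.
rewrite dot_scale ReZ ImZ -/(ip v x) b2 normrM gtr0_norm ?invr_gt0// => h0 h.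
have a01 : 0 <= a <= 1 by rewrite a0 ltW.
have := powR_tangent a01 h0 s0 => /(ler_wpM2l K0) /(le_trans h).
rewrite mulrC ler_pdivrMr// => {}h; apply: (le_trans h).
rewrite -!mulrA ler_wpM2l// ler_wpM2l ?powR_ge0// mulrDl.
by rewrite le_eqVlt; apply/orP; left; apply/eqP; field; rewrite !gt_eqF.
Qed.

(** The tangent at s = h is exact when h > 0; when h = 0, s tends to 0, and
    a = 0 is apart because 0 `^ 0 = 1. *)
Lemma parabolic_numrange K a T : 0 <= K -> 0 <= a -> a < 1 ->
  accretive T -> parabolic K a T -> numrange T `<=` Sregion a K.
Proof.
move=> K0 a0 a1 Tacc Tp z [[x v] /= [Txv x1 ->]]; split.
  exact: Tacc Txv.
have xx : ip x x = 1 by rewrite /ip dotE x1 expr1n.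
have h0 := Tacc _ _ Txv; have := Tp _ _ Txv; rewrite xx mulr1 -/(ip v x).
set y := `|_| => h; have [hz|hz] := eqVneq (ip v x) 0; last first.
  have hp : 0 < ip v x by rewrite lt_neqAle eq_sym hz.
  by have := h _ hp; rewrite divff// mulr1 (addrC a) subrK mulr1.
rewrite hz in h *.
have {}h s : 0 < s -> y <= K * s `^ a.
  move=> s0; apply: (le_trans (h _ s0)); rewrite mul0r mulr0 add0r ler_piMr//.
    by rewrite mulr_ge0// powR_ge0.
  by lra.
have [az|az] := eqVneq a 0.
  by have := h _ ltr01; rewrite az !powRr0.
rewrite powR0// mulr0; apply/ler_addgt0Pr => e e0; rewrite add0r.
have K1 : 0 < K + 1 by lra.
apply: (le_trans (h ((e / (K + 1)) `^ a^-1) _)).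
  by rewrite powR_gt0// divr_gt0.
rewrite -powRrM mulVf// powRr1; last by rewrite divr_ge0 ?ltW.
by rewrite mulrCA ler_piMr ?(ltW e0)// ler_pdivrMr// mul1r; lra.
Qed.

Lemma parabolic_add K K' a A B : 0 <= K -> 0 <= K' -> 0 <= a -> a < 1 ->
  accretive A -> accretive B -> parabolic K a A -> parabolic K' a B ->
  parabolic (2 * Num.max K K') a (opadd A B).
Proof.
move=> K0 K0' a0 a1 Aacc Bacc Ap Bp x _ [v [w [/= Axv Bxw ->]]] s s0.
have := Ap _ _ Axv _ s0; have := Bp _ _ Bxw _ s0.
have v0 : 0 <= ip v x / s by rewrite divr_ge0 ?(Aacc _ _ Axv)// ltW.
have w0 : 0 <= ip w x / s by rewrite divr_ge0 ?(Bacc _ _ Bxw)// ltW.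
have x0 := ip_ge0 x; rewrite ipDl [dot H (v + w) x]linearDl ImD [(ip v x + _) / s]mulrDl => h1 h2.
apply: (le_trans (ler_normD _ _)); apply: (le_trans (lerD h2 h1)).
have KM : K <= Num.max K K' by rewrite le_max lexx.
have KM' : K' <= Num.max K K' by rewrite le_max lexx orbT.
have sa := powR_gt0 a s0.
move: (Num.max K K') (s `^ a) (ip v x / s) (ip w x / s) (ip x x) KM KM' sa v0 w0 x0
  => M sa p q r KM KM' sa0 p0 q0 r0 {h1 h2}.
have M0 := le_trans K0 KM.
rewrite -!mulrA !(mulrCA _ sa) -mulrDr ler_pM2l//.
have P : 0 <= a * p + (1 - a) * r by rewrite addr_ge0// mulr_ge0//; lra.
have Q : 0 <= a * q + (1 - a) * r by rewrite addr_ge0// mulr_ge0//; lra.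
apply: (@le_trans _ _ (M * (a * p + (1 - a) * r) + M * (a * q + (1 - a) * r))).
  by apply: lerD; apply: ler_wpM2r.
have := mulr_ge0 M0 (mulr_ge0 a0 (addr_ge0 p0 q0)); lra.
Qed.

Lemma ip_near x v e : 0 < e -> exists2 d, 0 < d & forall x' v',
  nr (x' - x) < d -> nr (v' - v) < d -> `|ip v' x' - ip v x| < e.
Proof.
move=> e0; have q0 : 0 < 1 + nr x + nr v by have := nr_ge0 x; have := nr_ge0 v; lra.
exists (Num.min 1 (e / (1 + nr x + nr v))); first by rewrite lt_min ltr01 divr_gt0.
move=> x' v'; rewrite !lt_min !ltr_pdivlMr// => /andP[h1 h2] /andP[h3 h4].
have -> : ip v' x' - ip v x = ip (v' - v) (x' - x) + ip (v' - v) x + ip v (x' - x).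
  by rewrite !ipE; ring.
have := cauchy_schwarz (v' - v) (x' - x).
have := cauchy_schwarz (v' - v) x; have := cauchy_schwarz v (x' - x).
have := ler_normD (ip (v' - v) (x' - x) + ip (v' - v) x) (ip v (x' - x)).
have := ler_normD (ip (v' - v) (x' - x)) (ip (v' - v) x).
have := nr_ge0 x; have := nr_ge0 v; have := nr_ge0 (x' - x); have := nr_ge0 (v' - v).
move: (nr (x' - x)) (nr (v' - v)) h1 h2 h3 h4 => p q h1 h2 h3 h4; nra.
Qed.

Lemma parabolic_closure K a T : 0 <= K -> 0 <= a -> a < 1 ->
  parabolic K a T -> parabolic K a (closure T).
Proof.
move=> K0 a0 a1 Tp x v Txv s s0.
have sa := powR_gt0 a s0.
rewrite mulrDr !mulrA.
set c1 := K * _ * a; set c2 := K * _ * (1 - a).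
have c10 : 0 <= c1 / s by rewrite divr_ge0 ?(ltW s0)// !mulr_ge0// ltW.
have c20 : 0 <= c2 by rewrite !mulr_ge0 ?(ltW sa)//; lra.
apply/ler_addgt0Pr => e e0.
have q0 : 0 < 1 + c1 / s + c2 by lra.
have e1 := divr_gt0 e0 q0; set e' := e / _ in e1.
have [d1 d10 h1] := ip_near x v e1.
have [d2 d20 h2] := ip_near x x e1.
have [d3 d30 h3] := ip_near ('i%C *: x) v e1.
have d0 : 0 < Num.min d1 (Num.min d2 d3) by rewrite !lt_min d10 d20.
have [[x' v'] /= [Tx' ]] := closure_approx Txv d0.
rewrite !lt_min => /and3P[x1 x2 x3] /and3P[v1 v2 v3].
have := h1 _ _ x1 v1; have := h2 _ _ x2 x2.
have := h3 ('i%C *: x') v'; rewrite -scalerBr nr_i => /(_ x3 v3).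
have := Tp _ _ Tx' _ s0; rewrite !Im_dot mulrDr !mulrA -/c1 -/c2.
have := ler_distD (ip v' ('i%C *: x')) (ip v ('i%C *: x)) 0; rewrite !subr0 distrC.
have ee : e' + c1 / s * e' + c2 * e' = e.
  by rewrite -{1}(mul1r e') -!mulrDl mulrC divfK// gt_eqF.
rewrite -[c1 * _ / s]mulrAC -[c1 * ip v x / s]mulrAC.
move: (c1 / s) c10 ee {q0} => c c0 ee.
rewrite (ltr_norml (ip x' x' - _)) (ltr_norml (ip v' x' - _)).
move=> k1 k2 k3 /andP[_ k4] /andP[_ k5].
have := ler_wpM2l c0 (ltW k5); have := ler_wpM2l c20 (ltW k4); lra.
Qed.

Lemma parabolic_adj K a T : 0 <= K -> 0 <= a -> a < 1 ->
  m_accretive T -> parabolic K a T -> parabolic K a (opadjoint T).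
Proof.
move=> K0 a0 a1 hT Tp u f hu s s0.
have sa := powR_gt0 a s0.
rewrite mulrDr !mulrA.
set c1 := K * _ * a; set c2 := K * _ * (1 - a).
have c10 : 0 <= c1 / s by rewrite divr_ge0 ?(ltW s0)// !mulr_ge0// ltW.
have c20 : 0 <= c2 by rewrite !mulr_ge0 ?(ltW sa)//; lra.
apply/ler_addgt0Pr => e e0.
have q0 : 0 < (1 + c1 / s) * (1 + nr f).
  by rewrite mulr_gt0//; have := nr_ge0 f; lra.
have [d0 d00 hd] := res_cvg hT u (divr_gt0 e0 q0).
have d1 : 0 < d0 / 2 by rewrite divr_gt0.
have := hd _ d1; rewrite ltr_pdivrMr// mulr2n mulrDr mulr1 ltrDl => /(_ d00).
have [g [Tg g1 g2]] := adj_res_ip hT d1 hu.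
have := Tp _ _ Tg _ s0; rewrite g2 mulrDr !mulrA -/c1 -/c2.
have := res_nr hT u d1; rewrite -(@ler_pXn2r _ 2)// ?nnegrE ?nr_ge0// -!ip_nr.
set w := res _ _ _ in g1 g2 *.
have -> : complex.Im (dot H f u) = - complex.Im (dot H u f).
  by rewrite dotC; case: (dot H u f).
rewrite (ipC f) normrN !Im_dot.
have := cauchy_schwarz (w - u) ('i%C *: f); rewrite nr_i ipDl ipNl.
have := cauchy_schwarz (w - u) f; rewrite ipDl ipNl ler_norml => /andP[_ ].
have := ler_distD (ip w ('i%C *: f)) (ip u ('i%C *: f)) 0; rewrite !subr0 distrC.
rewrite -[c1 * _ / s]mulrAC -[c1 * ip u f / s]mulrAC ltr_pdivlMr//.
move: (c1 / s) c10 {q0} => c c0 k1 k2 k3 k4 k5 k6.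
have := ler_wpM2l c0 g1; have := ler_wpM2l c0 k2; have := ler_wpM2l c20 k4.
have := nr_ge0 (w - u); have := nr_ge0 f.
have := mulr_ge0 (nr_ge0 (w - u)) (nr_ge0 f).
have := mulr_ge0 c0 (nr_ge0 (w - u)).
lra.
Qed.
End Parabolic.

(** * The implicit Euler flow of a square root *)

Section Flow.
Context {R : realType} {H : hilbertType R}.
Implicit Types (T : set (H * H)%type) (X Y : (H * H)%type).

(** Twice the antisymmetric part of the real form of T, evaluated on elements of
    the graph; it vanishes when T is symmetric. *)
Definition asym X Y : R := ip X.2 Y.1 - ip Y.2 X.1.

(** Polarization: the imaginary part of the form at X + l i Y minus the one at
    X - l i Y is - 2 l times [asym X Y], while the cross terms of the two
    majorants cancel.  The weight l is left free in order to balance X and Y. *)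
Lemma asym_bound T (K a s l : R) X Y : 0 <= K -> 0 <= a -> a < 1 ->
  linear_operator T -> accretive T -> parabolic K a T ->
  T X -> T Y -> 0 < s -> 0 < l ->
  `|asym X Y| <= K * s `^ a *
     ((ip X.2 X.1 / l + l * ip Y.2 Y.1) / s + (ip X.1 X.1 / l + l * ip Y.1 Y.1)).
Proof.
case: X Y => [x v] [y w] K0 a0 a1 Tlin Tacc Tp TX TY s0 l0 /=; rewrite /asym /=.
(* the imaginary parts at X + l i Y and X - l i Y *)
pose iy := l%:C *: ('i%C *: y); pose iw := l%:C *: ('i%C *: w).
have Ti : T (iy, iw) by do 2 apply: lin_scale => //.
have := Tp _ _ (lin_add Tlin TX Ti) _ s0.
have := Tp _ _ (lin_sub Tlin TX Ti) _ s0.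
have ii (z t : H) : ip ('i%C *: z) ('i%C *: t) = ip z t.
  by rewrite -Im_dot linearZl_LR /= /ip; case: (dot H z t) => b c /=; ring.
have ir (z t : H) : ip ('i%C *: z) t = - ip z ('i%C *: t).
  by rewrite -Im_dot Im_dotl opprK.
have i2 (z : H) : 'i%C *: ('i%C *: z) = - z.
  by rewrite scalerA -expr2 sqr_i scaleN1r.
have iD (z t : H) : 'i%C *: (z + l%:C *: ('i%C *: t)) = 'i%C *: z - l%:C *: t.
  by rewrite scalerDr scalerA (mulrC _ l%:C) -scalerA i2 scalerN.
have iB (z t : H) : 'i%C *: (z - l%:C *: ('i%C *: t)) = 'i%C *: z + l%:C *: t.
  by rewrite scalerBr scalerA (mulrC _ l%:C) -scalerA i2 scalerN opprK.
rewrite !Im_dot /iy /iw iD iB !ipE !ii !ir.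
have vx := Tacc _ _ TX; have wy := Tacc _ _ TY.
have x0 := ip_ge0 x; have y0 := ip_ge0 y.
have c0 : 0 <= K * s `^ a by rewrite mulr_ge0// powR_ge0.
move: (K * s `^ a) c0 => c c0.
have ll := mulr_ge0 (ltW l0) (ltW l0).
have P0 : 0 <= (ip v x + l * l * ip w y) / s.
  by rewrite divr_ge0 ?(ltW s0)// addr_ge0// mulr_ge0.
have N0 : 0 <= ip x x + l * l * ip y y by rewrite addr_ge0// mulr_ge0.
have : c * (a * ((ip v x + l * l * ip w y) / s) + (1 - a) * (ip x x + l * l * ip y y))
  <= c * ((ip v x + l * l * ip w y) / s + (ip x x + l * l * ip y y)).
  by rewrite ler_wpM2l// lerD// ler_piMl//; lra.
have -> : c * ((ip v x / l + l * ip w y) / s + (ip x x / l + l * ip y y)) =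
  c * ((ip v x + l * l * ip w y) / s + (ip x x + l * l * ip y y)) / l.
  by field; rewrite !gt_eqF.
rewrite ler_pdivlMr//; set Q := c * (_ / s + _); set k := ip v y - ip w x.
have -> : `|k| * l = `|k * l| by rewrite normrM (gtr0_norm l0).
rewrite !ler_norml; move: (s^-1) => t h1 /andP[h2 h3] /andP[h4 h5].
apply/andP; split; rewrite /k; lra.
Qed.

(** Below, x solves x' = - y and y' = - z, that is x'' = z, along steps of
    length e. *)
Section Convex.
Context (x y z : nat -> H) (e : R) (e0 : 0 < e).
Context (xE : forall j, x j = x j.+1 + e%:C *: y j.+1).
Context (yE : forall j, y j = y j.+1 + e%:C *: z j.+1).
Context (xy : forall j, 0 <= ip (y j) (x j)) (yz : forall j, 0 <= ip (z j) (y j)).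

Lemma flow_dec j : ip (x j.+1) (x j.+1) <= ip (x j) (x j).
Proof.
rewrite [x j]xE !ipE (ipC (x j.+1)); have := mulr_ge0 (ltW e0) (xy j.+1).
have := mulr_ge0 (ltW e0) (mulr_ge0 (ltW e0) (ip_ge0 (y j.+1))); lra.
Qed.

Lemma flow_dec0 j : ip (x j) (x j) <= ip (x 0) (x 0).
Proof. by elim: j => // j IH; apply: (le_trans (flow_dec j)). Qed.

(** Discrete form of (|x|^2)'' = 2 <x'', x> + 2 |x'|^2. *)
Lemma flow_convex j :
  2 * e ^+ 2 * (ip (z j.+2) (x j.+2) + ip (y j.+2) (y j.+2)) <=
  ip (x j) (x j) - 2 * ip (x j.+1) (x j.+1) + ip (x j.+2) (x j.+2).
Proof.
rewrite (xE j) (yE j.+1) (xE j.+1) !ipE.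
have := mulr_ge0 (exprn_ge0 3 (ltW e0)) (yz j.+2).
have := mulr_ge0 (exprn_ge0 4 (ltW e0)) (ip_ge0 (z j.+2)).
move: (x j.+2) (y j.+2) (z j.+2) => a b c.
by rewrite (ipC a b) (ipC a c) (ipC b c); lra.
Qed.

(** Summation by parts against the weight j: a decreasing convex f >= 0 has
    the integral of t f''(t) bounded by f(0). *)
Lemma flow_sum n :
  \sum_(j < n) j.+1%:R * (2 * e ^+ 2 *
     (ip (z j.+2) (x j.+2) + ip (y j.+2) (y j.+2))) <= ip (x 0) (x 0).
Proof.
pose f j := ip (x j) (x j).
apply: (@le_trans _ _ (f 0 - n.+1%:R * f n + n%:R * f n.+1)).
  elim: n => [|n IH]; first by rewrite big_ord0 mul1r mul0r addr0 subrr.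
  rewrite big_ord_recr /=; have := ler_wpM2l (ler0n R n.+1) (flow_convex n).
  rewrite -/(f n) -/(f n.+1) -/(f n.+2) -/(f 0%N).
  by move: IH; rewrite -[n.+2%:R]natr1 -[n.+1%:R]natr1; set s := \sum_(_ < _) _; lra.
have := ler_wpM2l (ler0n R n) (flow_dec n); have := ip_ge0 (x n).
by rewrite -[n.+1%:R]natr1 -/(f 0%N) -/(f n) -/(f n.+1); lra.
Qed.

Lemma flow_dist j : (forall i, ip (y i) (y i) <= ip (y 0) (y 0)) ->
  nr (x 0 - x j) <= j%:R * e * nr (y 0).
Proof.
move=> y0; elim: j => [|j IH]; first by rewrite subrr nr0 !mul0r.
rewrite (_ : x 0 - x j.+1 = (x 0 - x j) + e%:C *: y j.+1); last first.
  by rewrite [in RHS](xE j) opprD addrA subrK.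
apply: (le_trans (nrD _ _)); rewrite nrZ gtr0_norm//.
have : nr (y j.+1) <= nr (y 0).
  by rewrite -(@ler_pXn2r _ 2)// ?nnegrE ?nr_ge0// -!ip_nr y0.
by move=> /(ler_wpM2l (ltW e0)); rewrite -natr1; move: IH; lra.
Qed.
End Convex.
End Flow.

(** * Comparison of the root with the form *)

Section Scale.
Context {R : realType}.
Implicit Types (a x e : R).

Lemma finite_max (f : nat -> R) n :
  exists2 j, (j <= n)%N & forall i, (i <= n)%N -> f i <= f j.
Proof.
elim: n => [|n [j jn hj]]; first by exists 0 => // i; rewrite leqn0 => /eqP ->.
have [h|h] := leP (f j) (f n.+1); [exists n.+1|exists j] => //.
- by move=> i; rewrite leq_eqVlt => /orP[/eqP ->//|/hj /le_trans]; apply.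
- exact: leqW.
- by move=> i; rewrite leq_eqVlt => /orP[/eqP ->|/hj//]; exact: ltW.
Qed.

(** The weight x^-a, which is s^a at the frequency scale s = 1/x. *)
Definition phi a x : R := x^-1 `^ a.

Lemma phi_ge0 a x : 0 <= phi a x.
Proof. exact: powR_ge0. Qed.

Lemma phiE a x : 0 < x -> phi a x * x = x `^ (1 - a).
Proof.
move=> x0; rewrite powRB ?(gt_eqF x0) ?implybT// powRr1 ?(ltW x0)// /phi.
by rewrite -(powR_inv1 (ltW x0)) -powRrM mulN1r powRN mulrC.
Qed.

(** Riemann sums of x^-a are bounded by its integral: each term is at most an
    increment of x^(1-a) / (1-a), by the tangent of x^(1-a) at the right
    endpoint. *)
Lemma phi_sum a e n : 0 <= a -> a < 1 -> 0 < e ->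
  \sum_(i < n) e * phi a (i.+1%:R * e) <= (n%:R * e) `^ (1 - a) / (1 - a).
Proof.
move=> a0 a1 e0; have g0 : 0 < 1 - a by lra.
elim: n => [|n IH].
  by rewrite big_ord0 mul0r powR0 ?mul0r// gt_eqF.
rewrite big_ord_recr /=; apply: (le_trans (lerD IH (lexx _))).
rewrite -(ler_pM2r g0) mulrDl divfK ?gt_eqF// divfK ?gt_eqF//.
have r0 : 0 < n.+1%:R * e by rewrite mulr_gt0.
have x0 : 0 <= n%:R * e by rewrite mulr_ge0// ltW.
have g01 : 0 <= 1 - a <= 1 by apply/andP; split; lra.
apply: (le_trans (lerD (powR_tangent g01 x0 r0) (lexx _))).
rewrite -phiE//; rewrite le_eqVlt; apply/orP; left; apply/eqP.
rewrite -[n.+1%:R]natr1; rewrite -[n.+1%:R]natr1 in r0; field.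
by rewrite natr1 !gt_eqF.
Qed.
End Scale.

(** Along the Euler scheme for S, the sequences u, p, q and r stand for u, Su,
    S^2 u = Tu and S^3 u = T p.  The pairs U = (u, Tu), P = (Su, T Su) and the
    displacement W = U - U_0 are elements of the graph of T.  The total time
    t = n e is at most 1, and M bounds the form along the flow. *)
Section Estimate.
Context {R : realType} {H : hilbertType R}.
Context (T : set (H * H)%type) (K a : R).
Context (K0 : 0 <= K) (a0 : 0 <= a) (a1 : a < 1).
Context (Tlin : linear_operator T) (Tacc : accretive T) (Tp : parabolic K a T).
Context (u p q r : nat -> H) (e : R) (e0 : 0 < e).
Context (uE : forall j, u j = u j.+1 + e%:C *: p j.+1).
Context (pE : forall j, p j = p j.+1 + e%:C *: q j.+1).
Context (qE : forall j, q j = q j.+1 + e%:C *: r j.+1).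
Context (up : forall j, 0 <= ip (p j) (u j)) (pq : forall j, 0 <= ip (q j) (p j)).
Context (qr : forall j, 0 <= ip (r j) (q j)).
Context (rb : forall j, nr (r j) <= nr (r 0)).
Context (TU : forall j, T (u j, q j)) (TP : forall j, T (p j, r j)).
Context (n : nat) (n0 : (0 < n)%N) (n1 : n%:R * e <= 1).
Context (M : R) (hM : forall j, (j <= n)%N -> ip (q j) (u j) <= M).

Let t : R := n%:R * e.
Let t0 : 0 < t. Proof. by rewrite mulr_gt0// ltr0n. Qed.
Let D := ip (p 0) (p 0).
Let E j := ip (p j) (p j) - ip (q j) (u j).
Let W j := (u j - u 0, q j - q 0).
Let P j := (p j, r j).
Let U j := (u j, q j).
Let pD j : ip (p j) (p j) <= D. Proof. exact: (flow_dec0 e0 pE pq). Qed.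
Let M0 : 0 <= M.
Proof. by apply: le_trans (hM (leq0n n)); exact: Tacc (TU 0). Qed.

(** The energy balance.  One step changes E by
    e asym(U_(j+1), P_(j+1)) up to e^2; antisymmetry turns U_(j+1) = U_j - e P_(j+1)
    into U_j = W_j + U_0, and the part with U_0 telescopes since the sum of the
    e P_(j+1) is U_0 - U_m. *)
Lemma flow_identity m : E 0 - E m =
  \sum_(j < m) e * asym (W j) (P j.+1) - asym (U 0) (U m) +
  \sum_(j < m) e ^+ 2 * (ip (q j.+1) (q j.+1) - ip (r j.+1) (p j.+1)).
Proof.
elim: m => [|m IH].
  by rewrite !big_ord0 /asym /U /=; ring.
rewrite !big_ord_recr /=.
rewrite -[LHS](subrKA (E m)) IH.
set s1 := \sum_(_ < _) _; set s2 := \sum_(_ < _) _.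
rewrite /E /asym /W /P /U /= (uE m) (pE m) (qE m) !ipE.
move: (u m.+1) (p m.+1) (q m.+1) (r m.+1) => x y z w.
rewrite ?(ipC y z) ?(ipC x z) ?(ipC x w) ?(ipC y w); ring.
Qed.

Lemma displacement_form j : (j <= n)%N -> ip (W j).2 (W j).1 <= 4 * M.
Proof.
move=> jn; rewrite /W /=.
have := Tacc (lin_add Tlin (TU j) (TU 0)); rewrite !ipE.
have := hM jn; have := hM (leq0n n); lra.
Qed.

Lemma displacement_dist j : ip (W j).1 (W j).1 <= (j%:R * e) ^+ 2 * D.
Proof.
rewrite /W /= ip_nr nrB /D ip_nr -exprMn.
rewrite ler_pXn2r ?nnegrE ?nr_ge0 ?mulr_ge0 ?nr_ge0 ?(ltW e0)//.
apply: flow_dist => //; exact: pD.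
Qed.

(** At time x = (i+1) e the polarized inequality is used with s = 1/x and
    l = x, which gives x^-a times h(W) + x^2 h(P) + |w|^2 / x + x |p|^2.  Here
    h(W) is bounded by M, h(P) is summable against x, and |w| <= x |p_0|. *)
Lemma asym_term i : (i.+1 <= n)%N ->
  `|e * asym (W i.+1) (P i.+2)| <=
  K * (4 * M * (e * phi a (i.+1%:R * e)) + t `^ (1 - a) *
    (i.+1%:R * e ^+ 2 * ip (r i.+2) (p i.+2) + 2 * D * e)).
Proof.
move=> i1; set x := i.+1%:R * e.
have x0 : 0 < x by rewrite mulr_gt0.
have xi : 0 < x^-1 by rewrite invr_gt0.
have TW : T (W i.+1) by exact: lin_sub.
have := asym_bound K0 a0 a1 Tlin Tacc Tp TW (TP i.+2) xi x0.
rewrite invrK /= -/(phi a x) normrM gtr0_norm// -/(P i.+2) => h.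
have := ler_wpM2l (ltW e0) h => {}h; apply: (le_trans h).
have xt : x `^ (1 - a) <= t `^ (1 - a).
  apply: ge0_ler_powR; rewrite ?nnegrE ?(ltW x0) ?(ltW t0)//; first by rewrite subr_ge0 ltW.
  by rewrite ler_pM2r// ler_nat.
have phx := phiE a x0; have phi0 := phi_ge0 a x.
have hP : 0 <= ip (r i.+2) (p i.+2) := Tacc (TP i.+2).
have h1 := displacement_form i1; have h2 := displacement_dist i.+1; have h3 := pD i.+2.
rewrite -/x /W /= in h1 h2 *.
have D0 : 0 <= D := ip_ge0 _.
have -> : i.+1%:R * e ^+ 2 = e * x by rewrite /x; ring.
rewrite -mulrA mulrCA ler_wpM2l//.
have w2 : ip (u i.+1 - u 0) (u i.+1 - u 0) / x <= x * D.
  by rewrite ler_pdivrMr// mulrAC -expr2.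
move: (ip (_ - _) _) (ip (_ - _) _) h1 w2 {h2 h} => w2 w1 h1 h2.
have -> : (w1 / x + x * ip (r i.+2) (p i.+2)) * x =
   w1 + x * x * ip (r i.+2) (p i.+2) by field; rewrite gt_eqF.
apply: (@le_trans _ _ (e * (phi a x * (4 * M + x * x * ip (r i.+2) (p i.+2)
   + 2 * (x * D))))).
  rewrite ler_wpM2l ?ler_wpM2l ?(ltW e0)//.
  by have := ler_wpM2l (ltW x0) h3; lra.
rewrite [leLHS](_ : _ = 4 * M * (e * phi a x) +
   (phi a x * x) * (e * x * ip (r i.+2) (p i.+2) + 2 * D * e)); last by ring.
have [x1 e1] := (ltW x0, ltW e0).
by rewrite phx lerD2l ler_wpM2r// addr_ge0// !mulr_ge0.
Qed.

(** The form of P is summed by [flow_sum], the rest by [phi_sum]; the common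
    factor t^(1-a) is small for short times. *)
Lemma asym_sum m : (m <= n)%N ->
  `|\sum_(j < m) e * asym (W j) (P j.+1)| <=
  K * t `^ (1 - a) * (5 / 2 * D + 4 / (1 - a) * M).
Proof.
case: m => [|m] mn.
  rewrite big_ord0 normr0 !mulr_ge0 ?powR_ge0// addr_ge0 ?mulr_ge0 ?ip_ge0//.
  by rewrite invr_ge0 subr_ge0 ltW.
(* the first term vanishes, as W_0 = 0; dividing by its time 0 would fail *)
rewrite big_ord_recl /= [asym (W 0) _](_ : _ = 0); last first.
  by rewrite /asym /W /= !subrr ip0l ip0r subrr.
rewrite mulr0 add0r.
apply: (le_trans (ler_norm_sum _ _ _)).
apply: (@le_trans _ _ (\sum_(i < m) K * (4 * M * (e * phi a (i.+1%:R * e)) + t `^ (1 - a) *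
    (i.+1%:R * e ^+ 2 * ip (r i.+2) (p i.+2) + 2 * D * e)))).
  by apply: ler_sum => i _; apply: asym_term; rewrite ltnW// (leq_trans _ mn)// ltnS.
rewrite -mulr_sumr -[leRHS]mulrA ler_wpM2l// big_split /=.
rewrite -[X in X + _]mulr_sumr -[X in _ + X]mulr_sumr big_split /=.
rewrite sumr_const card_ord -[_ *+ m]mulr_natl.
have mt : m%:R * e <= t by rewrite ler_pM2r// ler_nat ltnW.
have g0 : 0 < 1 - a by rewrite subr_gt0.
have s1 := phi_sum m a0 a1 e0.
have s1' : (m%:R * e) `^ (1 - a) <= t `^ (1 - a).
  apply: ge0_ler_powR; rewrite ?nnegrE ?mulr_ge0 ?(ltW e0) ?(ltW t0) ?(ltW g0)//.
have s2 := flow_sum e0 pE qE pq qr m.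
have {}s2 : \sum_(i < m) i.+1%:R * e ^+ 2 * ip (r i.+2) (p i.+2) <= D / 2.
  rewrite ler_pdivlMr//; apply: le_trans s2; rewrite mulr_suml.
  apply: ler_sum => i _; have := ip_ge0 (q i.+2).
  move=> /(mulr_ge0 (mulr_ge0 (ler0n R i.+1) (exprn_ge0 2 (ltW e0)))); lra.
have t1 := powR_ge0 t (1 - a).
have D0 : 0 <= D := ip_ge0 _.
have M4 : 0 <= 4 * M by rewrite mulr_ge0.
have s3 : m%:R * (2 * D * e) <= 2 * D.
  by rewrite mulrCA ler_piMr ?mulr_ge0//; exact: le_trans mt n1.
have g1 : 0 <= (1 - a)^-1 by rewrite invr_ge0 ltW.
have {}s1 := ler_wpM2l M4 (le_trans s1 (ler_wpM2r g1 s1')).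
have s4 := ler_wpM2l t1 (lerD s2 s3).
apply: (le_trans (lerD s1 s4)); rewrite le_eqVlt; apply/orP; left; apply/eqP.
by field; rewrite gt_eqF.
Qed.
Lemma flow_variation m : (m <= n)%N -> `|E 0 - E m| <=
  K * t `^ (1 - a) * (5 / 2 * D + (4 / (1 - a) + 2) * M) +
  2 * K * phi a t * ip (u 0) (u 0) + e * (ip (q 0) (q 0) + nr (r 0) * nr (p 0)).
Proof.
move=> mn; rewrite flow_identity.
have h1 := asym_sum mn.
have h2 : `|asym (U 0) (U m)| <=
    K * t `^ (1 - a) * (2 * M) + 2 * K * phi a t * ip (u 0) (u 0).
  have ti : 0 < t^-1 by rewrite invr_gt0.
  have := asym_bound K0 a0 a1 Tlin Tacc Tp (TU 0) (TU m) ti ltr01.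
  rewrite invrK /= !divr1 !mul1r -/(phi a t) => /le_trans; apply.
  rewrite -(phiE a t0) [leRHS](_ : _ = K * phi a t * (2 * M * t + 2 * ip (u 0) (u 0))); last by ring.
  rewrite ler_wpM2l ?mulr_ge0 ?phi_ge0// lerD//.
    by rewrite ler_wpM2r ?(ltW t0)//; have := hM (leq0n n); have := hM mn; lra.
  by have := flow_dec0 e0 uE up m; lra.
have h3 : `|\sum_(j < m) e ^+ 2 * (ip (q j.+1) (q j.+1) - ip (r j.+1) (p j.+1))|
    <= e * (ip (q 0) (q 0) + nr (r 0) * nr (p 0)).
  have C0 : 0 <= ip (q 0) (q 0) + nr (r 0) * nr (p 0).
    by rewrite addr_ge0 ?ip_ge0 ?mulr_ge0 ?nr_ge0.
  apply: (le_trans (ler_norm_sum _ _ _)).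
  apply: (@le_trans _ _ (\sum_(j < m) e ^+ 2 * (ip (q 0) (q 0) + nr (r 0) * nr (p 0)))).
    apply: ler_sum => j _; rewrite normrM ger0_norm ?exprn_ge0 ?(ltW e0)//.
    rewrite ler_wpM2l ?exprn_ge0 ?(ltW e0)//.
    have := flow_dec0 e0 qE qr j.+1; have := ip_ge0 (q j.+1).
    have := Tacc (TP j.+1); have := cauchy_schwarz (r j.+1) (p j.+1).
    rewrite ler_norml => /andP[_].
    have pm : nr (p j.+1) <= nr (p 0).
      by rewrite -(@ler_pXn2r _ 2)// ?nnegrE ?nr_ge0// -!ip_nr; exact: pD.
    have := ler_pM (nr_ge0 _) (nr_ge0 _) (rb j.+1) pm.
    by rewrite ler_norml => ? ? ? ? ?; apply/andP; split; lra.
  rewrite sumr_const card_ord -[_ *+ m]mulr_natl expr2 -!mulrA mulrCA.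
  rewrite ler_wpM2l ?(ltW e0)// mulrA ler_piMl//.
  by apply: le_trans n1; rewrite ler_pM2r// ler_nat.
move: (\sum_(_ < _) _) (\sum_(_ < _) _) h1 h3 => s1 s2 h1 h3.
apply: (le_trans (ler_normD _ _)).
have := ler_normB s2 (asym (U 0) (U m)).
move: (4 / (1 - a)) h1 => c h1.
have -> : K * t `^ (1 - a) * (5 / 2 * D + (c + 2) * M) =
  K * t `^ (1 - a) * (5 / 2 * D + c * M) + K * t `^ (1 - a) * (2 * M) by ring.
move: h1 h2 h3; lra.
Qed.

(** By [flow_sum] for u itself, h(u_j) + |p_j|^2 cannot stay large up to time t;
    at a time where it is small the variation of E bounds E_0. *)
Lemma flow_small : (2 <= n)%N -> exists2 m, (m <= n)%N &
  ip (q m) (u m) + ip (p m) (p m) <= 2 / t ^+ 2 * ip (u 0) (u 0).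
Proof.
move=> n2; have [N nE] : exists N, n = N.+2 by exists n.-2; rewrite -subn2 -addn2 subnK.
pose g j := ip (q j.+2) (u j.+2) + ip (p j.+2) (p j.+2).
have [j jN gj] := finite_max (fun j => - g j) N.
exists j.+2; first by rewrite nE; exact: jN.
rewrite -/(g j); have := flow_sum e0 uE pE up pq N.+1.
have -> : t = N.+2%:R * e by rewrite /t nE.
set s := \sum_(_ < _) _; set b := ip (u 0) (u 0) => sb.
have {}sb : N.+1%:R * N.+2%:R * e ^+ 2 * g j <= b.
  apply: le_trans sb; rewrite /s.
  have {s} : (\sum_(i < N.+1) i.+1%:R) * 2 = N.+1%:R * N.+2%:R :> R.
    elim: N.+1 => [|k IH]; first by rewrite big_ord0 !mul0r.
    by rewrite big_ord_recr mulrDl /= IH -!natr1; ring.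
  move=> <-; rewrite !mulr_suml; apply: ler_sum => i _.
  rewrite -!mulrA !ler_wpM2l ?(ltW e0)//.
  by have := gj i (ltn_ord i); rewrite lerN2.
have N2 : 0 < N.+2%:R * e by rewrite mulr_gt0.
rewrite mulrAC ler_pdivlMr ?exprn_gt0//.
apply: le_trans (ler_wpM2l (ler0n R 2) sb).
have g0 : 0 <= g j by rewrite addr_ge0 ?ip_ge0// ipC ipC; exact: Tacc (TU _).
rewrite [leLHS](_ : _ = N.+2%:R * (N.+2%:R * e ^+ 2 * g j)); last by ring.
rewrite [leRHS](_ : _ = (2 * N.+1%:R) * (N.+2%:R * e ^+ 2 * g j)); last by ring.
rewrite ler_wpM2r//; first by rewrite !mulr_ge0 ?exprn_ge0 ?(ltW e0).
by rewrite -natrM ler_nat mul2n -addnn addSn ltnS leq_addl.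
Qed.
End Estimate.

Section Core.
Context {R : realType} {H : hilbertType R}.

(** The total time t is chosen so short that [flow_variation] bounds the
    variation of E by (|Su|^2 + M) / 20, a multiple of |u|^2 and a term of
    order e.  At the time
    where the form attains its maximum M this gives M <= h(u) + variation, so M
    can be absorbed; at the time provided by [flow_small] it bounds E_0 itself.
    The step e depends on u, but t and the constant do not. *)
Lemma core_estimate (S T : set (H * H)%type) (K a : R) :
  0 <= K -> 0 <= a -> a < 1 ->
  m_accretive S -> (S \; S)%relation = T ->
  linear_operator T -> accretive T -> parabolic K a T ->
  exists2 C, 0 <= C & forall u p q r, S (u, p) -> S (p, q) -> S (q, r) ->
    `|ip p p - ip q u| <= 2^-1 * (ip p p + ip q u) + C * ip u u.
Proof.
move=> K0 a0 a1 hS ST Tlin Tacc Tp.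
have g0 : 0 < 1 - a by rewrite subr_gt0.
(* c dominates both coefficients, 5/2 and 4/(1-a) + 2, of flow_variation *)
pose c := 4 / (1 - a) + 3.
have c3 : 3 <= c by rewrite /c lerDr divr_ge0// ltW.
have c0 : 0 <= c := le_trans (ler0n R 3) c3.
have Kc1 : 0 < 20 * (K * c + 1) by have := mulr_ge0 K0 c0; lra.
pose t1 := (20 * (K * c + 1))^-1.
have t10 : 0 < t1 by rewrite invr_gt0.
pose t := Num.min 1 (t1 `^ (1 - a)^-1).
have t0 : 0 < t by rewrite lt_min ltr01 powR_gt0.
have tle1 : t <= 1 by rewrite ge_min lexx.
have tg : t `^ (1 - a) <= t1.
  have -> : t1 = (t1 `^ (1 - a)^-1) `^ (1 - a).
    by rewrite -powRrM mulVf ?gt_eqF// powRr1// ltW.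
  apply: ge0_ler_powR; rewrite ?nnegrE ?powR_ge0 ?(ltW t0) ?(ltW g0)//.
  by rewrite ge_min lexx orbT.
have kc : K * t `^ (1 - a) * c <= 20^-1.
  rewrite mulrAC; apply: (@le_trans _ _ (K * c * t1)).
    by rewrite ler_wpM2l// mulr_ge0.
  rewrite /t1 ler_pdivrMr// mulrA mulVf ?pnatr_eq0// mul1r; lra.
have k0 : 0 <= K * t `^ (1 - a) by rewrite mulr_ge0 ?powR_ge0.
set k := K * _ in kc k0.
pose k2 := 2 * K * phi a t.
have k20 : 0 <= k2 by rewrite !mulr_ge0 ?phi_ge0.
exists (2 / t ^+ 2 + 2 * k2).
  by rewrite addr_ge0 ?divr_ge0 ?(mulr_ge0 _ k20)// exprn_ge0// ltW.
move=> u p q r Sup Spq Sqr; apply/ler_addgt0Pr => e' e'0.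
pose C := ip q q + nr r * nr p.
have C0 : 0 <= C by rewrite addr_ge0 ?ip_ge0 ?mulr_ge0 ?nr_ge0.
have C1 : 0 < 2 * (1 + C) by lra.
have [N hN] := invSn_small (divr_gt0 e'0 C1).
(* at least two steps, so that flow_small applies *)
pose n := N.+2; have := hN N.+1 (leqnSn _); rewrite -/n => {}hN.
have n0 : 0 < n%:R :> R by rewrite ltr0n.
pose e := t / n%:R.
have e0 : 0 < e by rewrite divr_gt0.
have ne : n%:R * e = t by rewrite mulrC divfK ?gt_eqF.
have eC : e * C <= e' / 2.
  have : e <= n%:R^-1 by rewrite ler_piMl// ltW// invr_gt0.
  move=> /(ler_wpM2r C0) /le_trans; apply.
  have := ler_wpM2r C0 (ltW hN) => /le_trans; apply.
  by rewrite mulrAC ler_pdivrMr//; lra.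
pose J := res S e.
pose it (x : H) j := iter j J x.
have itS x y : S (x, y) -> forall j, S (it x j, it y j).
  by move=> Sxy; elim=> // j IH; exact: res_comm.
have itE x y (Sxy : S (x, y)) j : it x j = it x j.+1 + e%:C *: it y j.+1.
  by have := res_dom hS e0 (itS _ _ Sxy j) => /= <-; rewrite addrC subrK.
have itA x y (Sxy : S (x, y)) j : 0 <= ip (it y j) (it x j).
  exact: m_accretive_acc (itS _ _ Sxy j).
have itN x j : nr (it x j) <= nr (it x 0).
  by elim: j => // j IH; exact: le_trans (res_nr hS _ e0) IH.
have TU j : T (it u j, it q j) by rewrite -ST; exists (it p j); exact: itS.
have TP j : T (it p j, it r j) by rewrite -ST; exists (it q j); exact: itS.
have [j0 j0n hM] := finite_max (fun j => ip (it q j) (it u j)) n.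
have nle1 : n%:R * e <= 1 by rewrite ne.
have var := flow_variation K0 a0 a1 Tlin Tacc Tp e0 (itE _ _ Sup) (itE _ _ Spq)
  (itE _ _ Sqr) (itA _ _ Sup) (itA _ _ Spq) (itA _ _ Sqr) (itN r) TU TP (isT : (0 < n)%N) nle1 hM.
have [m mn small] := flow_small Tacc e0 (itE _ _ Sup) (itE _ _ Spq)
  (itA _ _ Sup) (itA _ _ Spq) TU (isT : (1 < n)%N).
rewrite ne in var small.
have v1 := var _ j0n; have v2 := var _ mn.
have pd := flow_dec0 e0 (itE _ _ Spq) (itA _ _ Spq) j0.
have hm := Tacc _ _ (TU m); have hu := Tacc _ _ (TU 0).
have D0 := ip_ge0 p; have pm := ip_ge0 (it p m).
move: small v1 v2 pd hu; rewrite /= -/k -/k2 -/C.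
have Mge := Tacc _ _ (TU j0).
have bnd : k * (5 / 2 * ip p p + (4 / (1 - a) + 2) * ip (it q j0) (it u j0)) <=
    20^-1 * (ip p p + ip (it q j0) (it u j0)).
  apply: (@le_trans _ _ (k * c * (ip p p + ip (it q j0) (it u j0)))).
    rewrite -[leRHS]mulrA ler_wpM2l// mulrDr lerD// ler_wpM2r//; first lra.
    by rewrite /c lerD2l; lra.
  by rewrite ler_wpM2r// addr_ge0.
rewrite !ler_norml; move: (k * _) bnd => B bnd.
move: (ip (it q j0) _) (ip (it p j0) _) (ip (it q m) _) (ip (it p m) _) (ip p p)
  (ip q u) (ip u u) D0 Mge hm pm bnd => M pj qm pm' D h b D0 Mge hm pm bnd.
rewrite [(2 / t ^+ 2 + 2 * k2) * b](_ : _ = 2 / t ^+ 2 * b + 2 * (k2 * b)); last by ring.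
move: (2 / t ^+ 2 * b) (k2 * b) eC => G kb.
move: (e * C) => ec eC.
move=> s1 /andP[s2 s3] /andP[s4 s5] s6 s7.
apply/andP; split; lra.
Qed.
End Core.

(** * Form domains and domains of square roots *)

Section FormDomain.
Context {R : realType} {H : hilbertType R}.
Implicit Types (S T : set (H * H)%type) (u v w : H).

(** The domain of the closure of the form of T, encoded by approximants of
    bounded form: convexity makes it unnecessary to ask that they be Cauchy in
    the form norm. *)
Definition form_domain T : set H := [set u | exists M : R,
  forall e : R, 0 < e -> exists v w, [/\ T (v, w), nr (v - u) < e & ip w v <= M]].

(** The approximants are (1 + d S)^-2 u: they lie in D(S^3), and the resolvent
    commutes with S, so |Su| bounds their form. *)
Lemma root_sub_form_domain T S : m_accretive S -> (S \; S)%relation = T ->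
  forall C : R, 0 <= C ->
  (forall u p q r, S (u, p) -> S (p, q) -> S (q, r) ->
     ip q u <= 3 * ip p p + C * ip u u) ->
  opdom S `<=` form_domain T.
Proof.
move=> hS ST C C0 core u [g Sug].
exists (3 * ip g g + C * ip u u) => e e0.
have g1 : 0 < 2 * (1 + nr g) by have := nr_ge0 g; lra.
pose d := e / (2 * (1 + nr g)).
have d0 : 0 < d by rewrite divr_gt0.
pose J := res S d.
have Sr y := resP hS y d0.
have S1 := res_comm hS d0 (res_comm hS d0 Sug).
have S2 := res_comm hS d0 (Sr g).
have := Sr (d^-1%:C *: (g - J g)); rewrite -/J; set r := _ *: (_ - J _) => S3.
exists (J (J u)), (J (d^-1%:C *: (g - J g))); split.
- by rewrite -ST; exists (J (J g)).
- have -> : J (J u) - u = J (J u - u) + (J u - u).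
    by rewrite /J resB// addrA subrK.
  apply: (le_lt_trans (nrD _ _)).
  have h1 := res_dist hS d0 Sug; have h2 := res_nr hS (J u - u) d0.
  have : 2 * d * (1 + nr g) = e by rewrite /d; field; have := nr_ge0 g; lra.
  rewrite -/J in h1 h2 *; lra.
- apply: (le_trans (core _ _ _ _ S1 S2 S3)).
  have sq x : ip (J (J x)) (J (J x)) <= ip x x.
    rewrite !ip_nr ler_pXn2r ?nnegrE ?nr_ge0//.
    exact: le_trans (res_nr hS _ d0) (res_nr hS _ d0).
  by rewrite lerD// ler_wpM2l.
Qed.

(** One resolvent of S moves the approximants from D(S^2) into D(S^3) with an
    arbitrarily small change of the form; then their images under S are bounded,
    a convergent selection of these images exists, and S is closed. *)
Lemma form_domain_sub_root T S : m_accretive S -> (S \; S)%relation = T ->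
  forall C : R, 0 <= C ->
  (forall u p q r, S (u, p) -> S (p, q) -> S (q, r) ->
     ip p p <= 3 * ip q u + C * ip u u) ->
  form_domain T `<=` opdom S.
Proof.
move=> hS ST C C0 core u [M hM].
have Slin := m_accretive_lin hS.
pose K n := [set y | exists2 x, S (x, y) & nr (x - u) < n.+1%:R^-1].
have [||n|k [l [Kk kl]]] := @convex_selection _ _ K (3 * (M + 1) + C * (nr u + 1) ^+ 2).
- move=> n y [x Sxy xu]; exists x => //; apply: (lt_trans xu).
  by rewrite ltf_pV2 ?posrE// ltr_nat.
- move=> n y y' [x Sx xu] [x' Sx' xu']; exists (2^-1%:C *: (x + x')).
    by apply: lin_scale => //; apply: lin_add.
  have -> : 2^-1%:C *: (x + x') - u = 2^-1%:C *: ((x - u) + (x' - u)).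
    rewrite addrACA -opprD scalerBr; congr (_ - _).
    by rewrite midpoint_refl.
  rewrite nrZ gtr0_norm ?invr_gt0//; have := nrD (x - u) (x' - u).
  by move: (n.+1%:R^-1) xu xu' => r; lra.
- have n0 : 0 < n.+1%:R^-1 / 2 :> R by rewrite divr_gt0// invr_gt0.
  have [v [w [Tvw vu wv]]] := hM _ n0.
  move: Tvw; rewrite -ST => -[p /= Svp Spw].
  have [d1 d10 near1] := ip_near v w (ltr01 : 0 < 1 :> R).
  have [d2 d20 cvg1] := res_cvg hS v d10.
  have [d3 d30 cvg2] := res_cvg hS w d10.
  have [d4 d40 cvg3] := res_cvg hS v n0.
  pose d := Num.min d2 (Num.min d3 d4) / 2.
  have m0 : 0 < Num.min d2 (Num.min d3 d4) by rewrite !lt_min d20 d30.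
  have d0 : 0 < d by rewrite divr_gt0.
  have : d < Num.min d2 (Num.min d3 d4) by rewrite /d; lra.
  rewrite !lt_min => /and3P[/(cvg1 _ d0) v1 /(cvg2 _ d0) w1 /(cvg3 _ d0) v2].
  have S1 := res_comm hS d0 Svp; have S2 := res_comm hS d0 Spw.
  have S3 := resP hS w d0.
  exists (res S d p); first exists (res S d v) => //.
    rewrite (_ : _ - u = (res S d v - v) + (v - u)); last by rewrite addrA subrK.
    by apply: (le_lt_trans (nrD _ _)); move: (n.+1%:R^-1) vu v2 => r; lra.
  apply: (le_trans (core _ _ _ _ S1 S2 S3)); apply: lerD.
    by have := near1 _ _ v1 w1; rewrite ltr_norml => /andP[_]; lra.
  rewrite ler_wpM2l// ip_nr ler_pXn2r ?nnegrE ?nr_ge0 ?addr_ge0 ?nr_ge0//.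
  apply: (le_trans (res_nr hS _ d0)).
  have : n.+1%:R^-1 <= 1 :> R by rewrite invf_le1// ler1n.
  have := nrD (v - u) u; rewrite subrK.
  by move: (n.+1%:R^-1) vu => r; lra.
exists l; apply: (m_accretive_closed hS) => e e0.
have [N1 h1] := kl _ e0; have [N2 h2] := invSn_small e0.
pose n := maxn N1 N2; have [x Sx xu] := Kk n.
exists (x, k n); split => //=; last exact: h1 (leq_maxl _ _).
exact: lt_trans xu (h2 _ (leq_maxr _ _)).
Qed.

Lemma root_domain T S (K a : R) : 0 <= K -> 0 <= a -> a < 1 ->
  m_accretive T -> parabolic K a T ->
  m_accretive S -> (S \; S)%relation = T -> opdom S = form_domain T.
Proof.
move=> K0 a0 a1 hT Tp hS ST.
have [C C0 core] := core_estimate K0 a0 a1 hS ST (m_accretive_lin hT)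
  (m_accretive_acc hT) Tp.
have C20 : 0 <= 2 * C by rewrite mulr_ge0.
apply/seteqP; split.
- apply: (root_sub_form_domain hS ST C20) => u p q r Sup Spq Sqr.
  by have := core _ _ _ _ Sup Spq Sqr; rewrite ler_norml => /andP[]; lra.
- apply: (form_domain_sub_root hS ST C20) => u p q r Sup Spq Sqr.
  by have := core _ _ _ _ Sup Spq Sqr; rewrite ler_norml => /andP[]; lra.
Qed.

(** Approximants in D(T^* ) are regularized by the resolvent of T, which does not
    increase their form in the limit ([adj_res_ip]). *)
Lemma form_domain_adj_sub T : m_accretive T ->
  form_domain (opadjoint T) `<=` form_domain T.
Proof.
move=> hT u [M hM]; exists (M + 1) => e e0.
have e2 : 0 < e / 2 by rewrite divr_gt0.
have [v [f [Tvf vu fv]]] := hM _ e2.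
have m0 : 0 < Num.min 1 (e / 2) by rewrite lt_min ltr01.
have [d d0 []] := res_ip hT v f m0.
rewrite !lt_min => /andP[_ h1] /andP[h2 _].
have [g [Tg gf _]] := adj_res_ip hT d0 Tvf.
exists (res T d v), g; split => //.
- rewrite (_ : _ - u = (res T d v - v) + (v - u)); last by rewrite addrA subrK.
  by apply: (le_lt_trans (nrD _ _)); lra.
- by move: h2; rewrite ltr_norml (ipC v) => /andP[_]; lra.
Qed.

Lemma form_domain_adj T : m_accretive T ->
  form_domain (opadjoint T) = form_domain T.
Proof.
move=> hT; apply/seteqP; split; first exact: form_domain_adj_sub.
by rewrite -{1}(adj_adj hT); apply: form_domain_adj_sub; exact: adj_m_accretive.
Qed.

Lemma opsqrtP T : (exists S, m_accretive S /\ (S \; S)%relation = T) ->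
  m_accretive (opsqrt T) /\ (opsqrt T \; opsqrt T)%relation = T.
Proof. exact: (@xgetPex _ set0 [set S | m_accretive S /\ (S \; S)%relation = T]). Qed.

Lemma opsqrt0 T : ~ (exists S, m_accretive S /\ (S \; S)%relation = T) ->
  opsqrt T = set0.
Proof. by move=> h; apply: xgetPN => S hS; apply: h; exists S. Qed.

(** Which root is chosen does not matter, as [root_domain] holds for each of
    them; if T has no root then neither has its adjoint, and both sides are the
    domain of the same dummy value. *)
Lemma opsqrt_domain_adj T (K a : R) : 0 <= K -> 0 <= a -> a < 1 ->
  m_accretive T -> parabolic K a T ->
  opdom (opsqrt T) = opdom (opsqrt (opadjoint T)).
Proof.
move=> K0 a0 a1 hT Tp; have hA := adj_m_accretive hT.
have adj_root U : (exists S, m_accretive S /\ (S \; S)%relation = U) ->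
    exists S, m_accretive S /\ (S \; S)%relation = opadjoint U.
  move=> [S [hS SU]]; exists (opadjoint S); split; first exact: adj_m_accretive.
  exact: adj_comp.
have [ex|nex] := pselect (exists S, m_accretive S /\ (S \; S)%relation = T).
- have [h1 h2] := opsqrtP ex; have [h3 h4] := opsqrtP (adj_root _ ex).
  rewrite (root_domain K0 a0 a1 hT Tp h1 h2).
  rewrite (root_domain K0 a0 a1 hA (parabolic_adj K0 a0 a1 hT Tp) h3 h4).
  by rewrite form_domain_adj.
- rewrite !opsqrt0// => ex; apply: nex.
  by rewrite -(adj_adj hT); exact: adj_root.
Qed.
End FormDomain.

Theorem theorem3p5 (R : realType) (H : hilbertType R) (alpha beta beta' : R)
    (A B : set (H * H)%type)
    (halpha0 : 0 <= alpha) (halpha1 : alpha < 1)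
    (hbeta : 0 < beta) (hbeta' : 0 < beta')
    (hA : m_accretive A) (hB : m_accretive B)
    (hAinv : invertible A) (hBinv : invertible B)
    (hdense : dense (opdom A `&` opdom B))
    (hAS : numrange A `<=` Sregion alpha beta)
    (hBS : numrange B `<=` Sregion alpha beta')
    (hAB : m_accretive (closure (opadd A B))) :
  opdom (opsqrt (closure (opadd A B)))
    = opdom (opsqrt (opadjoint (closure (opadd A B))))
  /\ numrange (closure (opadd A B))
       `<=` Sregion alpha (2 * Num.max beta beta').
Proof.
have K0 : 0 <= 2 * Num.max beta beta'.
  by rewrite mulr_ge0// le_max (ltW hbeta).
have Cp : parabolic (2 * Num.max beta beta') alpha (closure (opadd A B)).
  apply: parabolic_closure => //.
  have [hb hb'] := (ltW hbeta, ltW hbeta').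
  apply: parabolic_add => //; try exact: m_accretive_acc.
    by apply: numrange_parabolic => //; exact: m_accretive_lin.
  by apply: numrange_parabolic => //; exact: m_accretive_lin.
split; first exact: opsqrt_domain_adj K0 _ _ hAB Cp.
by apply: parabolic_numrange => //; exact: m_accretive_acc.
Qed.
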